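(* Let $G$ be an abelian group. The compact convex set $\mathcal{P}^{\mathbb{H}}_*(G)$ (with the topology of pointwise convergence) is a Bauer simplex if and only if $G$ has exponent $\le 2$ (equivalently, $G$ is a vector space over $\mathbb{Z}_2$).
   Context: $\mathbb{H}$ is the real quaternion algebra. For an abelian group $G$, $\phi:G\to\mathbb{H}$ is positive definite if for all $k$, $g_i\in G$, $q_i\in\mathbb{H}$, $\sum_{i,j=1}^k\overline{q_i}\,\phi(g_j-g_i)\,q_j$ is a nonnegative real number; $\mathcal{P}^{\mathbb{H}}_*(G)$ is the set of such $\phi$ with $\phi(0)=1$, viewed as a compact convex subset of $\mathbb{H}^G$ with the product (pointwise convergence) topology. A Bauer simplex is a compact convex set $K$ in a locally convex Hausdorff space whose extreme boundary is closed and such that every point of $K$ is the barycenter of a unique Radon probability measure supported on the extreme boundary (equivalently, a Choquet simplex with closed extreme boundary). *)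

(* Defs.v *)
From HB Require Import structures.
From mathcomp Require Import all_boot all_order all_algebra.
From mathcomp Require Import all_classical all_reals all_analysis.
From mathcomp Require Import Rstruct Rstruct_topology.

Set Implicit Arguments.
Unset Strict Implicit.
Unset Printing Implicit Defensive.

Import Order.TTheory GRing.Theory Num.Theory.
Local Open Scope classical_set_scope.
Local Open Scope ring_scope.

Notation RR := Rdefinitions.R.

(* The real quaternion algebra H, with underlying real vector space R^4   *)
(* (with its usual topology): q = q_0 + q_1 i + q_2 j + q_3 k.            *)
Definition quat := 'rV[RR]_4.

Definition qc (q : quat) (n : nat) : RR := q ord0 (inord n).

Definition qmake (a b c d : RR) : quat := \row_(i < 4) [:: a; b; c; d]`_i.

Definition qmul (p q : quat) : quat :=
  let a1 := qc p 0 in let b1 := qc p 1 in let c1 := qc p 2 in let d1 := qc p 3 in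
  let a2 := qc q 0 in let b2 := qc q 1 in let c2 := qc q 2 in let d2 := qc q 3 in
  qmake (a1 * a2 - b1 * b2 - c1 * c2 - d1 * d2)
        (a1 * b2 + b1 * a2 + c1 * d2 - d1 * c2)
        (a1 * c2 - b1 * d2 + c1 * a2 + d1 * b2)
        (a1 * d2 + b1 * c2 - c1 * b2 + d1 * a2).

Definition qconj (q : quat) : quat := qmake (qc q 0) (- qc q 1) (- qc q 2) (- qc q 3).

Definition qone : quat := qmake 1 0 0 0.

Definition qnonneg_real (q : quat) : Prop :=
  [/\ 0 <= qc q 0, qc q 1 = 0, qc q 2 = 0 & qc q 3 = 0].

Definition qpos_def (G : zmodType) (phi : G -> quat) : Prop :=
  forall (k : nat) (g : 'I_k -> G) (q : 'I_k -> quat),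
    qnonneg_real (\sum_(i < k) \sum_(j < k) qmul (qmul (qconj (q i)) (phi (g j - g i))) (q j)).

Definition Pstar (G : zmodType) : set (G -> quat) :=
  [set phi | qpos_def phi /\ phi 0 = qone].

Definition qspace (G : zmodType) := {ptws G -> quat}.

Definition ccomb (G : zmodType) (t : RR) (y z : G -> quat) : G -> quat :=
  fun g => t *: y g + (1 - t) *: z g.

Definition convex_set_q (G : zmodType) (K : set (G -> quat)) : Prop :=
  forall y z t, K y -> K z -> 0 <= t <= 1 -> K (ccomb t y z).

Definition ext_boundary (G : zmodType) (K : set (G -> quat)) : set (G -> quat) :=
  [set x | K x /\ forall y z t, K y -> K z -> 0 < t < 1 ->
                   x = ccomb t y z -> y = x /\ z = x].

Definition qborel (G : zmodType) := g_sigma_algebraType (@open (qspace G)).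

Definition radon (G : zmodType) (mu : probability (qborel G) RR) : Prop :=
  forall A : set (qborel G), measurable A ->
    mu A = ereal_sup [set mu C | C in [set C : set (qspace G) | compact C /\ C `<=` A]].

Definition cont_lin_functional (G : zmodType) (l : qspace G -> RR) : Prop :=
  continuous l /\
  forall (a : RR) (u v : G -> quat), l (fun g => a *: u g + v g) = a * l u + l v.

Definition barycenter (G : zmodType) (mu : probability (qborel G) RR) (x : G -> quat) : Prop :=
  forall l : qspace G -> RR, cont_lin_functional l ->
    (\int[mu]_(y in [set: qborel G]) (l y)%:E = (l x)%:E)%E.

Definition bauer_simplex (G : zmodType) (K : set (G -> quat)) : Prop :=
  [/\ compact (K : set (qspace G)), convex_set_q K,
      closed (ext_boundary K : set (qspace G)) &
      forall x, K x ->
        let P := fun mu : probability (qborel G) RR =>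
          [/\ radon mu, mu (~` ext_boundary K) = 0%E & barycenter mu x] in
        exists mu, P mu /\
          forall nu, P nu -> forall A : set (qborel G), measurable A -> nu A = mu A].

Arguments Pstar : clear implicits.

(* Main.v *)
(** Only if.  Quaternionic automorphisms and [x |-> - x] act on [Pstar G].  If
    [g + g <> 0] then some element of [Pstar G] is not real at [g], hence so is
    some extreme point [psi].  With [R] the rotation [i -> j -> -i], the real
    function [(psi + psi(-.)) / 2] is also [(R psi + R psi(-.)) / 2], and this
    gives two different representing measures, each a mean of two Dirac masses.

    If.  When [G] has exponent 2 every positive definite [phi] is real, and
    [x |-> (phi x + s phi (x + g)) / 2] with [s = +-1] is again positive
    definite: it is the transform of the would-be representing measure
    restricted to the characters with value [s] at [g].  So the extreme points
    are the characters [G -> {+-1}], and iterating gives the mass of every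
    cylinder of [{+-1}^G].  This finitely additive mass extends to a Radon
    measure because cylinders are compact and open.  Conversely the barycenter
    determines the mass of the cylinders, hence by inner regularity that of
    the open sets, hence the measure. *)

From HB Require Import structures.
Require Import Defs.
From mathcomp Require Import all_boot all_order all_algebra.
From mathcomp Require Import ring lra.
From mathcomp Require Import all_classical all_reals all_analysis measurable_realfun.
From mathcomp Require Import Rstruct Rstruct_topology.

Set Implicit Arguments.
Unset Strict Implicit.
Unset Printing Implicit Defensive.

Import Order.TTheory GRing.Theory Num.Theory.
Import numFieldNormedType.Exports.
Local Open Scope classical_set_scope.
Local Open Scope ring_scope.

(** * Quaternions *)

Lemma qc_qmake0 a b c d : qc (qmake a b c d) 0 = a.
Proof. by rewrite /qc mxE inordK. Qed.
Lemma qc_qmake1 a b c d : qc (qmake a b c d) 1 = b.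
Proof. by rewrite /qc mxE inordK. Qed.
Lemma qc_qmake2 a b c d : qc (qmake a b c d) 2 = c.
Proof. by rewrite /qc mxE inordK. Qed.
Lemma qc_qmake3 a b c d : qc (qmake a b c d) 3 = d.
Proof. by rewrite /qc mxE inordK. Qed.
Lemma qcD p q n : qc (p + q) n = qc p n + qc q n.
Proof. by rewrite /qc mxE. Qed.
Lemma qcN p n : qc (- p) n = - qc p n.
Proof. by rewrite /qc mxE. Qed.
Lemma qcZ a p n : qc (a *: p) n = a * qc p n.
Proof. by rewrite /qc mxE. Qed.
Lemma qc0 n : qc 0 n = 0.
Proof. by rewrite /qc mxE. Qed.
Lemma qc_sum (I : Type) (r : seq I) (P : pred I) (F : I -> quat) n :
  qc (\sum_(i <- r | P i) F i) n = \sum_(i <- r | P i) qc (F i) n.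
Proof. by apply: (big_morph (qc^~ n)) => [p q|]; rewrite ?qcD ?qc0. Qed.

Definition qcE := (qc_qmake0, qc_qmake1, qc_qmake2, qc_qmake3, qcD, qcN, qcZ, qc0).

Lemma qext p q : qc p 0 = qc q 0 -> qc p 1 = qc q 1 -> qc p 2 = qc q 2 ->
  qc p 3 = qc q 3 -> p = q.
Proof.
rewrite /qc => h0 h1 h2 h3; apply/rowP => i.
by rewrite -(inord_val i); case: i => [[|[|[|[|]]]]].
Qed.

Lemma qcP p q : (forall n, qc p n = qc q n) -> p = q.
Proof. by move=> h; apply: qext. Qed.

Ltac qring := apply: qext; rewrite /qmul /qconj /qone ?qcE; ring.

Lemma qmulDl p q r : qmul (p + q) r = qmul p r + qmul q r.
Proof. by qring. Qed.
Lemma qmulDr p q r : qmul p (q + r) = qmul p q + qmul p r.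
Proof. by qring. Qed.
Lemma qmulZl a p q : qmul (a *: p) q = a *: qmul p q.
Proof. by qring. Qed.
Lemma qmulZr a p q : qmul p (a *: q) = a *: qmul p q.
Proof. by qring. Qed.
Lemma qmul0 p : qmul 0 p = 0. Proof. by qring. Qed.
Lemma qmulr0 p : qmul p 0 = 0. Proof. by qring. Qed.
Lemma qmulA p q r : qmul p (qmul q r) = qmul (qmul p q) r.
Proof. by qring. Qed.
Lemma qmul1 p : qmul qone p = p. Proof. by qring. Qed.
Lemma qmulr1 p : qmul p qone = p. Proof. by qring. Qed.
Lemma qconjM p q : qconj (qmul p q) = qmul (qconj q) (qconj p).
Proof. by qring. Qed.
Lemma qconjD p q : qconj (p + q) = qconj p + qconj q. Proof. by qring. Qed.
Lemma qconj0 : qconj 0 = 0. Proof. by qring. Qed.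
Lemma qconj1 : qconj qone = qone. Proof. by qring. Qed.
Lemma qconjZ a p : qconj (a *: p) = a *: qconj p. Proof. by qring. Qed.

Lemma qmul_suml (I : Type) (r : seq I) (P : pred I) (F : I -> quat) p :
  qmul (\sum_(i <- r | P i) F i) p = \sum_(i <- r | P i) qmul (F i) p.
Proof. by apply: (big_morph (qmul^~ p)) => [q s|]; rewrite ?qmulDl ?qmul0. Qed.
Lemma qmul_sumr (I : Type) (r : seq I) (P : pred I) (F : I -> quat) p :
  qmul p (\sum_(i <- r | P i) F i) = \sum_(i <- r | P i) qmul p (F i).
Proof. by apply: (big_morph (qmul p)) => [q s|]; rewrite ?qmulDr ?qmulr0. Qed.
Lemma qconj_sum (I : Type) (r : seq I) (P : pred I) (F : I -> quat) :
  qconj (\sum_(i <- r | P i) F i) = \sum_(i <- r | P i) qconj (F i).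
Proof. by apply: (big_morph qconj) => [q s|]; rewrite ?qconjD ?qconj0. Qed.

Lemma qnonneg_realD p q :
  qnonneg_real p -> qnonneg_real q -> qnonneg_real (p + q).
Proof.
by move=> [? p1 p2 p3] [? q1 q2 q3]; split; rewrite qcE ?p1 ?q1 ?p2 ?q2 ?p3 ?q3;
  rewrite ?addr0 ?addr_ge0.
Qed.

Lemma qnonneg_real0 : qnonneg_real 0.
Proof. by split; rewrite qcE. Qed.

Lemma qnonneg_realZ a p : 0 <= a -> qnonneg_real p -> qnonneg_real (a *: p).
Proof.
by move=> a0 [? p1 p2 p3]; split; rewrite qcE ?p1 ?p2 ?p3 ?mulr0 ?mulr_ge0.
Qed.

Lemma qnonneg_real_sqr p : qnonneg_real (qmul (qconj p) p).
Proof. by split; rewrite /qmul /qconj !qcE; [nra|ring|ring|ring]. Qed.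

(** * Positive definite functions *)

Section positive_definite.
Variable G : zmodType.
Implicit Types (phi psi : G -> quat) (g h x : G).

Lemma qpos_defD phi psi : qpos_def phi -> qpos_def psi ->
  qpos_def (fun x => phi x + psi x).
Proof.
move=> hp hs k g q; have := qnonneg_realD (hp k g q) (hs k g q).
congr qnonneg_real; rewrite -big_split; apply: eq_bigr => i _ /=.
by rewrite -big_split; apply: eq_bigr => j _ /=; rewrite qmulDr qmulDl.
Qed.

Lemma qpos_defZ a phi : 0 <= a -> qpos_def phi -> qpos_def (fun x => a *: phi x).
Proof.
move=> a0 hp k g q; have := qnonneg_realZ a0 (hp k g q).
congr qnonneg_real; rewrite scaler_sumr; apply: eq_bigr => i _ /=.
by rewrite scaler_sumr; apply: eq_bigr => j _ /=; rewrite qmulZr qmulZl.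
Qed.

Lemma qpos_def_opp phi : qpos_def phi -> qpos_def (fun x => phi (- x)).
Proof.
move=> hp k g q; have := hp k (fun i => - g i) q; congr qnonneg_real.
by apply: eq_bigr => i _; apply: eq_bigr => j _; rewrite opprB opprK addrC.
Qed.

(* The form of the new function at (g, q) is the form of phi at the doubled
   configuration (g, q), (g + h, c q). *)
Lemma qpos_def_translate phi (c : quat) h : qpos_def phi ->
  qpos_def (fun x => phi x + qmul (qmul (qconj c) (phi x)) c
                     + qmul (phi (x + h)) c + qmul (qconj c) (phi (x - h))).
Proof.
move=> hp k g q.
pose g2 (i : 'I_(k + k)) :=
  match fintype.split i with inl i => g i | inr i => g i + h end.
pose q2 (i : 'I_(k + k)) :=
  match fintype.split i with inl i => q i | inr i => qmul c (q i) end.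
have := hp _ g2 q2; congr qnonneg_real; rewrite big_split_ord /=.
rewrite -big_split; apply: eq_bigr => i _ /=.
rewrite !big_split_ord /= -!big_split; apply: eq_bigr => j _ /=.
rewrite /g2 /q2 !(unsplitK (inl _)) !(unsplitK (inr _)).
rewrite (_ : g j + h - (g i + h) = g j - g i); last by rewrite opprD addrACA subrr addr0.
rewrite (_ : g j + h - g i = g j - g i + h); last by rewrite addrAC.
rewrite opprD addrA !qmulDr !qmulDl qconjM !qmulA.
by rewrite -!addrA; congr (_ + _); rewrite addrA addrC.
Qed.

Lemma qpos_def_delta : qpos_def (fun x => if x == 0 then qone else 0).
Proof.
(* [t i] is a canonical index of the class of points equal to [g i]. Grouping by classes turns the
   form into a sum of squares [qmul (qconj (S o)) (S o)]; the class [None] is empty and contributes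
   0. *)
move=> k g q; pose t i := [pick j | g j == g i].
have tE i j : (t i == t j) = (g j - g i == 0).
  rewrite subr_eq0; apply/eqP/eqP => [|gij]; last first.
    by rewrite /t; apply: eq_pick => l; rewrite gij.
  rewrite /t; case: pickP => [l /eqP gl|/(_ i)]; last by rewrite eqxx.
  case: pickP => [m /eqP gm|/(_ j)]; last by rewrite eqxx.
  by move=> [lm]; rewrite -gl -gm lm.
pose S o := \sum_(i < k | t i == o) q i.
suff -> : \sum_(i < k) \sum_(j < k)
     qmul (qmul (qconj (q i)) (if g j - g i == 0 then qone else 0)) (q j)
   = \sum_o qmul (qconj (S o)) (S o).
  by elim/big_ind: _ => [|p r|o _]; [exact: qnonneg_real0|exact: qnonneg_realD|
    exact: qnonneg_real_sqr].
rewrite (partition_big t xpredT) //=; apply: eq_bigr => o _.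
rewrite qconj_sum qmul_suml; apply: eq_bigr => i /eqP ti.
rewrite qmul_sumr [RHS]big_mkcond; apply: eq_bigr => j _.
rewrite -tE ti eq_sym; case: eqP => _; first by rewrite qmulr1.
by rewrite qmulr0 qmul0.
Qed.

Lemma qpos_def2 phi g (p q : quat) : qpos_def phi ->
  qnonneg_real (qmul (qmul (qconj p) (phi 0)) p + qmul (qmul (qconj p) (phi g)) q
    + (qmul (qmul (qconj q) (phi (- g))) p + qmul (qmul (qconj q) (phi 0)) q)).
Proof.
move=> hp; have := hp 2 (fun i => if i == ord0 then 0 else g)
  (fun i => if i == ord0 then p else q).
by rewrite !big_ord_recl !big_ord0 /= !addr0 !subrr sub0r subr0.
Qed.

Lemma qpos_def0 phi : qpos_def phi -> qnonneg_real (phi 0).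
Proof.
move=> hp; have := hp 1%N (fun=> 0) (fun=> qone).
by rewrite !big_ord_recl !big_ord0 /= !addr0 subrr qconj1 qmul1 qmulr1.
Qed.

(** Reality of the form on the points 0, [g] with coefficients (1, 1) makes the imaginary parts
    opposite; with coefficients (1, i), the i-component makes the real parts equal. *)
Lemma qpos_def_conj phi g : qpos_def phi -> phi (- g) = qconj (phi g).
Proof.
move=> hp; have [_ h1 h2 h3] := qpos_def0 hp; set r := qc (phi 0) 0.
have e0 : phi 0 = r *: qone.
  by apply: qext; rewrite /qone !qcE ?h1 ?h2 ?h3 ?/r; lra.
have [_ + + +] := qpos_def2 g qone qone hp.
rewrite e0 qconj1 !qmul1 !qmulr1 /qone !qcE => a1 a2 a3.
have [_ + _ _] := qpos_def2 g qone (qmake 0 1 0 0) hp.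
rewrite e0 qconj1 !qmul1 !qmulr1 qmulZr qmulZl qmulr1 !qcE.
move: (phi g) (phi (- g)) a1 a2 a3 => p p' a1 a2 a3.
rewrite ?qcE => b1.
by apply: qext; rewrite /qconj !qcE; lra.
Qed.

Lemma qpos_def_norm phi g : qpos_def phi ->
  qc (phi g) 0 ^+ 2 + qc (phi g) 1 ^+ 2 + qc (phi g) 2 ^+ 2 + qc (phi g) 3 ^+ 2
    <= qc (phi 0) 0 ^+ 2.
Proof.
move=> hp; have [h0 h1 h2 h3] := qpos_def0 hp.
set a := qc (phi g) 0; set b := qc (phi g) 1; set c := qc (phi g) 2;
set d := qc (phi g) 3; set r := qc (phi 0) 0.
(* This is the form with coefficients [phi g] at 0 and [- t] at [g]. If [r > 0], the choice [t = r]
   gives the bound after division by [r]; if [r = 0], [t = 1] does. *)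
have key t : 0 <= (a ^+ 2 + b ^+ 2 + c ^+ 2 + d ^+ 2 + t ^+ 2) * r
    - t * (a ^+ 2 + b ^+ 2 + c ^+ 2 + d ^+ 2) *+ 2.
  have [h _ _ _] := qpos_def2 g (phi g) (qmake (- t) 0 0 0) hp.
  move: h; rewrite (qpos_def_conj g hp) /qmul /qconj !qcE h1 h2 h3.
  by rewrite -/a -/b -/c -/d -/r => h; lra.
have [r0|r0] := ltrP 0 r.
  rewrite -subr_ge0 -(pmulr_rge0 _ r0); have := key r; congr (0 <= _); ring.
have r00 : r = 0 by apply/eqP; rewrite eq_le r0.
by have := key 1; rewrite r00 mulr0; lra.
Qed.

End positive_definite.

(** * Necessity of exponent 2 *)

Section mean_of_diracs.
Context d (T : measurableType d) (R : realType).
Local Open Scope ereal_scope.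

Definition dirac_mean (a b : T) : set T -> \bar R :=
  mscale ((2^-1 : R)%:nng)%R (measure_add (dirac a) (dirac b)).

HB.instance Definition _ a b := Measure.on (dirac_mean a b).

Lemma dirac_meanE a b (A : set T) :
  dirac_mean a b A = (2^-1)%:E * (\d_a A + \d_b A).
Proof. by rewrite /dirac_mean /mscale /= /msum 2!big_ord_recl /= big_ord0 adde0. Qed.

Let dirac_mean_setT a b : dirac_mean a b setT = 1.
Proof.
rewrite dirac_meanE !diracT -EFinD -EFinM; congr EFin; lra.
Qed.

HB.instance Definition _ a b :=
  Measure_isProbability.Build _ _ _ (dirac_mean a b) (dirac_mean_setT a b).

Lemma integral_dirac_mean a b (f : T -> R) : measurable_fun setT f ->
  \int[dirac_mean a b]_x (f x)%:E = ((f a + f b) / 2)%:E.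
Proof.
move=> mf; have mf' : measurable_fun setT (EFin \o f) by exact/measurable_EFinP.
rewrite integralE /dirac_mean !ge0_integral_mscale //; last 2 first.
  exact: measurable_funeneg.
  exact: measurable_funepos.
rewrite !ge0_integral_measure_add //; last 2 first.
  exact: measurable_funeneg.
  exact: measurable_funepos.
rewrite !integral_dirac //; last 4 first.
  exact: measurable_funeneg.
  exact: measurable_funeneg.
  exact: measurable_funepos.
  exact: measurable_funepos.
rewrite !diracT !mul1e !funenegE !funeposE /= -!EFin_max -!EFinD.
congr EFin; rewrite /Num.max.
by do 4 case: ltP => ?; lra.
Qed.

End mean_of_diracs.

(** * Topology and Borel structure of the quaternion-valued functions *)

Section qspace_topology.
Variable G : zmodType.

Lemma qspace_eval_continuous (g : G) : continuous (fun y : qspace G => y g).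
Proof. exact: (@proj_continuous G (fun=> quat) g). Qed.

Lemma qspace_coord_continuous (g : G) n :
  continuous (fun y : qspace G => qc (y g) n : RR).
Proof.
move=> y; apply: (@continuous_comp (qspace G) quat RR (fun y => y g) (qc^~ n)).
  exact: qspace_eval_continuous.
exact: coord_continuous.
Qed.

Lemma qspace_coord_cont_lin (g : G) n :
  cont_lin_functional (fun y : qspace G => qc (y g) n).
Proof.
by split=> [|a u v]; [exact: qspace_coord_continuous|rewrite !qcE].
Qed.

Lemma open_qborel (A : set (qspace G)) : open A -> measurable (A : set (qborel G)).
Proof. by move=> oA; apply: sub_sigma_algebra. Qed.

Lemma closed_qborel (A : set (qspace G)) :
  closed A -> measurable (A : set (qborel G)).
Proof.
move=> /closed_openC/open_qborel mA.
by rewrite -(setCK A); exact: measurableC.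
Qed.

Lemma continuous_qborel (l : qspace G -> RR) :
  continuous l -> measurable_fun setT (l : qborel G -> (RR : realType)).
Proof.
move=> cl; apply: (measurability _ (RGenOInfty.measurableE RR)).
move=> _ [_ [a ->] <-]; rewrite setTI; apply: open_qborel.
by apply: open_comp => // y _; exact: cl.
Qed.

End qspace_topology.

(** A decomposition of [T x] in [K] is pulled back by the affine inverse [T'] to one of [x], where
    extremality applies. *)
Lemma ext_boundary_aut (G : zmodType) (K : set (G -> quat))
    (T T' : (G -> quat) -> G -> quat) :
  cancel T T' -> cancel T' T ->
  (forall y, K y -> K (T y)) -> (forall y, K y -> K (T' y)) ->
  (forall t y z, T' (ccomb t y z) = ccomb t (T' y) (T' z)) ->
  forall x, ext_boundary K x -> ext_boundary K (T x).
Proof.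
move=> TK T'K KT KT' T'c x [Kx ex]; split=> [|y z t Ky Kz t01 Tx]; first exact: KT.
have [|yx zx] := ex _ _ t (KT' _ Ky) (KT' _ Kz) t01; first by rewrite -T'c -Tx TK.
by rewrite -[y]T'K -[z]T'K yx zx.
Qed.

(* Conjugation by 1 + k, an automorphism of H: i -> j -> -i. *)
Definition qrot (q : quat) : quat := qmake (qc q 0) (- qc q 2) (qc q 1) (qc q 3).
Definition qrotV (q : quat) : quat := qmake (qc q 0) (qc q 2) (- qc q 1) (qc q 3).

Lemma qrotK : cancel qrot qrotV.
Proof. by move=> q; apply: qext; rewrite !qcE ?opprK. Qed.
Lemma qrotVK : cancel qrotV qrot.
Proof. by move=> q; apply: qext; rewrite !qcE ?opprK. Qed.
Lemma qrotD : {morph qrot : p q / p + q}.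
Proof. by move=> p q; rewrite /qrot; qring. Qed.
Lemma qrotM : {morph qrot : p q / qmul p q}.
Proof. by move=> p q; rewrite /qrot; qring. Qed.
Lemma qrot_conj : {morph qrot : p / qconj p}.
Proof. by move=> p; rewrite /qrot; qring. Qed.
Lemma qrot0 : qrot 0 = 0. Proof. by rewrite /qrot; qring. Qed.
Lemma qrot1 : qrot qone = qone. Proof. by rewrite /qrot; qring. Qed.
Lemma qrotZ a : {morph qrot : p / a *: p}.
Proof. by move=> p; rewrite /qrot; qring. Qed.
Lemma qrotVD : {morph qrotV : p q / p + q}.
Proof. by move=> p q; rewrite -{1}(qrotVK p) -{1}(qrotVK q) -qrotD qrotK. Qed.
Lemma qrotVM : {morph qrotV : p q / qmul p q}.
Proof. by move=> p q; rewrite -{1}(qrotVK p) -{1}(qrotVK q) -qrotM qrotK. Qed.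
Lemma qrotV_conj : {morph qrotV : p / qconj p}.
Proof. by move=> p; rewrite -{1}(qrotVK p) -qrot_conj qrotK. Qed.
Lemma qrotV0 : qrotV 0 = 0. Proof. by rewrite -{1}qrot0 qrotK. Qed.
Lemma qrotV1 : qrotV qone = qone. Proof. by rewrite -{1}qrot1 qrotK. Qed.
Lemma qrotVZ a : {morph qrotV : p / a *: p}.
Proof. by move=> p; rewrite -{1}(qrotVK p) -qrotZ qrotK. Qed.

(** * Symmetries of [Pstar G] and an element that is not real *)

Section Pstar_symmetries.
Variable G : zmodType.
Implicit Types phi : G -> quat.

(** The form of [T \o phi] with coefficients [q] is the image under [T] of the form of [phi] with
    coefficients [T' \o q]. *)
Lemma qpos_def_aut (T T' : quat -> quat) phi :
  cancel T' T -> {morph T : p q / p + q} -> {morph T : p q / qmul p q} ->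
  {morph T : p / qconj p} -> T 0 = 0 ->
  (forall p, qnonneg_real p -> qnonneg_real (T p)) ->
  qpos_def phi -> qpos_def (T \o phi).
Proof.
move=> TK TD TM Tc T0 Tnn hp k g q; have := Tnn _ (hp k g (T' \o q)).
rewrite (big_morph T TD T0); congr qnonneg_real; apply: eq_bigr => i _.
by rewrite (big_morph T TD T0); apply: eq_bigr => j _; rewrite !TM Tc /= !TK.
Qed.

Lemma Pstar_qrot phi : Pstar G phi -> Pstar G (qrot \o phi).
Proof.
move=> [hp h0]; split; last by rewrite /= h0 qrot1.
apply: qpos_def_aut hp; [exact: qrotVK|exact: qrotD|exact: qrotM|
  exact: qrot_conj|exact: qrot0|].
by move=> p [h p1 p2 p3]; split; rewrite !qcE ?p1 ?p2 ?p3 ?oppr0.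
Qed.

Lemma Pstar_qrotV phi : Pstar G phi -> Pstar G (qrotV \o phi).
Proof.
move=> [hp h0]; split; last by rewrite /= h0 qrotV1.
apply: qpos_def_aut hp; [exact: qrotK|exact: qrotVD|exact: qrotVM|
  exact: qrotV_conj|exact: qrotV0|].
by move=> p [h p1 p2 p3]; split; rewrite !qcE ?p1 ?p2 ?p3 ?oppr0.
Qed.

Lemma Pstar_opp phi : Pstar G phi -> Pstar G (fun x => phi (- x)).
Proof. by move=> [/qpos_def_opp hp h0]; split; rewrite ?oppr0. Qed.

Lemma ext_boundary_qrot phi :
  ext_boundary (Pstar G) phi -> ext_boundary (Pstar G) (qrot \o phi).
Proof.
apply: (@ext_boundary_aut _ _ (fun y => qrot \o y) (fun y => qrotV \o y)).
- by move=> y; apply/funext => x /=; rewrite qrotK.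
- by move=> y; apply/funext => x /=; rewrite qrotVK.
- exact: Pstar_qrot.
- exact: Pstar_qrotV.
- by move=> t y z; apply/funext => x; rewrite /ccomb /= qrotVD !qrotVZ.
Qed.

Lemma ext_boundary_opp phi :
  ext_boundary (Pstar G) phi -> ext_boundary (Pstar G) (fun x => phi (- x)).
Proof.
have oppKf (y : G -> quat) : (fun x => y (- - x)) = y.
  by apply/funext => x; rewrite opprK.
exact: (@ext_boundary_aut _ _ (fun y x => y (- x)) (fun y x => y (- x)) oppKf
  oppKf Pstar_opp Pstar_opp).
Qed.

(* delta_0 + (delta_{-g} i - i delta_g) / 2 *)
Definition skew_delta (g x : G) : quat :=
  let delta y := if y == 0 then qone else 0 in
  let i := qmake 0 1 0 0 in
  2^-1 *: (delta x + qmul (qmul (qconj i) (delta x)) i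
            + qmul (delta (x + g)) i + qmul (qconj i) (delta (x - g))).

Lemma Pstar_skew_delta (g : G) : g <> 0 -> Pstar G (skew_delta g).
Proof.
move=> /eqP g0; split.
  apply: qpos_defZ; first by rewrite invr_ge0.
  exact/qpos_def_translate/qpos_def_delta.
rewrite /skew_delta eqxx add0r sub0r oppr_eq0 (negbTE g0).
by apply: qext; rewrite /qmul /qconj /qone !qcE; lra.
Qed.

(** As [g <> - g], the summand at [- g] is absent at [g], and only -i/2 remains. *)
Lemma skew_delta_i (g : G) : g + g <> 0 -> qc (skew_delta g g) 1 = - 2^-1.
Proof.
move=> /eqP gg0; rewrite /skew_delta subrr eqxx (negbTE gg0).
have /negbTE -> : g != 0 by apply: contraNneq gg0 => ->; rewrite addr0.
by rewrite /qmul /qconj /qone !qcE; lra.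
Qed.

End Pstar_symmetries.

(** * Two representing measures for one point *)

Section not_simplex.
Variable G : zmodType.

Lemma dirac_mean_probE (a b : qborel G) (A : set (qborel G)) :
  (dirac_mean RR a b : probability (qborel G) RR) A =
  (2^-1 * ((a \in A)%:R + (b \in A)%:R))%:E.
Proof. by have := @dirac_meanE _ (qborel G) RR a b A; rewrite !diracE. Qed.

(** The supremum is attained at the finite, hence compact, set of those of the two points that lie
    in [A]. *)
Lemma radon_dirac_mean (a b : qborel G) : radon (dirac_mean _ a b).
Proof.
move=> A mA; apply/eqP; rewrite eq_le; apply/andP; split; last first.
  apply: ge_ereal_sup => _ [C [cC CA] <-].
  rewrite !dirac_mean_probE lee_fin ler_pM2l ?invr_gt0//.
  have le_in (c : qborel G) : ((c \in (C : set (qborel G)))%:R : RR) <= (c \in A)%:R.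
    by rewrite ler_nat; case: (boolP (c \in _)) => // /set_mem/CA/mem_set ->.
  exact: lerD.
apply: ereal_sup_ubound; exists (A `&` [set a; b]).
  split; last exact: subIsetl.
  apply/finite_compact/(sub_finite_set (@subIsetr _ _ _)).
  by rewrite finite_setU; split; exact: finite_set1.
rewrite !dirac_mean_probE !in_setI.
by rewrite !(@mem_set _ [set a; b]) ?andbT; [|right|left].
Qed.

Lemma barycenter_dirac_mean (a b x : G -> quat) :
  (forall g, x g = 2^-1 *: (a g + b g)) ->
  barycenter (dirac_mean RR (a : qborel G) (b : qborel G)) x.
Proof.
move=> xE l [cl ll]; rewrite integral_dirac_mean; last exact: continuous_qborel.
have l0 : l (fun=> 0) = 0.
  by have := ll 1 (fun=> 0) (fun=> 0); rewrite scale1r addr0; lra.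
have lZ t u : l (fun g => t *: u g) = t * l u.
  have := ll t u (fun=> 0); rewrite l0 addr0 => <-.
  by congr l; apply/funext => g; rewrite addr0.
have -> : x = (fun g => 2^-1 *: a g + (fun g => 2^-1 *: b g) g).
  by apply/funext => g; rewrite xE scalerDr.
by rewrite ll lZ; congr EFin; lra.
Qed.

Lemma bauer_simplex_exponent : bauer_simplex (Pstar G) -> forall g : G, g + g = 0.
Proof.
move=> [_ conv cE rep] g; apply: contrapT => gg0.
have g0 : g <> 0 by move=> g0; apply: gg0; rewrite g0 addr0.
(* Otherwise the i-coordinate at [g] vanishes on the extreme boundary, so it integrates to 0 against
   a representing measure of [skew_delta g], whose i-coordinate at [g] is -1/2. Closedness of the
   boundary makes its complement measurable. *)
have [y Ey y1] : exists2 y, ext_boundary (Pstar G) y & qc (y g) 1 <> 0.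
  apply: contrapT => noy.
  have [mu [[_ muE /(_ _ (qspace_coord_cont_lin g 1))]]] :=
    rep _ (Pstar_skew_delta g0).
  rewrite skew_delta_i // => intE _.
  have mE := open_qborel (closed_openC cE).
  move: intE; rewrite (ae_eq_integral (cst 0%E)) //; last 2 first.
  - by apply/measurable_EFinP; exact: (continuous_qborel (@qspace_coord_continuous _ g 1)).
  - exists (~` ext_boundary (Pstar G)); split=> // z /= zn Ez; apply: zn => _.
    by congr EFin; apply: contrapT => z1; apply: noy; exists z.
  by rewrite integral0 => -[]; lra.
have [Ky _] := Ey; have [pdy y0] := Ky.
pose y' x := y (- x).
pose x z := 2^-1 *: (y z + y' z).
have Kx : Pstar G x.
  have := conv y y' 2^-1 Ky (Pstar_opp Ky); rewrite (_ : ccomb _ _ _ = x).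
    by apply; lra.
  by apply/funext => z; rewrite /ccomb /x scalerDr; congr (_ + _ *: _); lra.
(* Since [y (- z)] is the conjugate of [y z], the mean [x z] is the real part of [y z], which [qrot]
   preserves. *)
have xrot z : x z = 2^-1 *: (qrot (y z) + qrot (y' z)).
  rewrite /x /y' (qpos_def_conj z pdy).
  by apply: qext; rewrite /qrot /qconj !qcE; lra.
have [mu [_ mu_uniq]] := rep _ Kx.
have suppE a b : ext_boundary (Pstar G) a -> ext_boundary (Pstar G) b ->
    (dirac_mean RR (a : qborel G) (b : qborel G) : probability (qborel G) RR)
      (~` ext_boundary (Pstar G)) = 0%E.
  by move=> Ea Eb; rewrite dirac_mean_probE !memNset ?addr0 ?mulr0 //; apply.
have mu1 := mu_uniq (dirac_mean RR (y : qborel G) (y' : qborel G)).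
have mu2 := mu_uniq (dirac_mean RR (qrot \o y : qborel G) (qrot \o y' : qborel G)).
(* [A] contains [y], so the first measure gives it mass at least 1/2. It misses both rotated points,
   since membership would force the i-coordinate of [y g] to be 0; so the second measure gives it
   mass 0. *)
pose A := [set z : qspace G | qc (z g) 1 = qc (y g) 1] `&`
  [set z : qspace G | qc (z g) 2 = qc (y g) 2].
have mA : measurable (A : set (qborel G)).
  apply: closed_qborel; apply: closedI.
    by apply: (@closed_comp _ _ (fun z : qspace G => qc (z g) 1 : RR)
      [set qc (y g) 1]) => [z _|]; [exact: qspace_coord_continuous|exact: closed_eq].
  by apply: (@closed_comp _ _ (fun z : qspace G => qc (z g) 2 : RR)
      [set qc (y g) 2]) => [z _|]; [exact: qspace_coord_continuous|exact: closed_eq].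
have Ey' : ext_boundary (Pstar G) y' by exact: ext_boundary_opp.
have E1 := mu1 (And3 (radon_dirac_mean _ _) (suppE _ _ Ey Ey')
  (barycenter_dirac_mean (fun=> erefl))) A mA.
have E2 := mu2 (And3 (radon_dirac_mean _ _)
  (suppE _ _ (ext_boundary_qrot Ey) (ext_boundary_qrot Ey'))
  (barycenter_dirac_mean xrot)) A mA.
move: E1; rewrite -E2 !dirac_mean_probE => -[].
rewrite mem_set; last by [].
rewrite [(qrot \o y) \in _]memNset; last first.
  by rewrite /A /= /qrot !qcE => -[? ?]; apply: y1; lra.
rewrite [(qrot \o y') \in _]memNset; last first.
  rewrite /A /= /y' (qpos_def_conj g pdy) /qrot /qconj !qcE => -[? ?].
  by apply: y1; lra.
by move=> /eqP; rewrite addr0 mulr0 mulf_eq0 invr_eq0 pnatr_eq0 /= gt_eqF ?ltr_pwDl.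
Qed.

End not_simplex.

(** * Radon extension of a finitely additive mass *)

Section radon_extension.
Context (R : realType) (X : ptopologicalType).
Variables (Cyl : set (set X)) (m : set X -> R).
Hypothesis X_compact : compact [set: X].
Hypothesis CylT : Cyl setT.
Hypothesis CylC : forall V, Cyl V -> Cyl (~` V).
Hypothesis CylI : forall V W, Cyl V -> Cyl W -> Cyl (V `&` W).
Hypothesis Cyl_open : forall V, Cyl V -> open V.
Hypothesis Cyl_base : forall x A, nbhs x A -> exists V, [/\ Cyl V, V x & V `<=` A].
Hypothesis m_ge0 : forall V, Cyl V -> 0 <= m V.
Hypothesis mU : forall V W, Cyl V -> Cyl W -> V `&` W = set0 ->
  m (V `|` W) = m V + m W.

Let Cyl0 : Cyl set0. Proof. by rewrite -setCT; exact: CylC. Qed.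

Let CylU V W : Cyl V -> Cyl W -> Cyl (V `|` W).
Proof.
by move=> cV cW; rewrite -(setCK (V `|` W)) setCU; apply/CylC/CylI; exact: CylC.
Qed.

Let m0 : m set0 = 0.
Proof. by have := mU Cyl0 Cyl0; rewrite setI0 setU0 => /(_ erefl); lra. Qed.

Let mDI V W : Cyl V -> Cyl W -> m V = m (V `&` W) + m (V `&` ~` W).
Proof.
move=> cV cW; rewrite -mU; [|exact: CylI|by apply: CylI => //; exact: CylC|].
  by rewrite -setIUr setUCr setIT.
by rewrite setIACA setICr setI0.
Qed.

Let m_le V W : Cyl V -> Cyl W -> V `<=` W -> m V <= m W.
Proof.
move=> cV cW VW; rewrite (mDI cW cV) setIidr // lerDl.
by apply/m_ge0/CylI => //; exact: CylC.
Qed.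

Let m_subadd (I : Type) (s : seq I) (W : I -> set X) V :
  Cyl V -> (forall i, Cyl (W i)) -> V `<=` \big[setU/set0]_(i <- s) W i ->
  m V <= \sum_(i <- s) m (W i).
Proof.
move=> cV cW; elim: s V cV => [|i s ih] V cV; rewrite !(big_nil, big_cons).
  by rewrite subset0 => ->; rewrite m0.
move=> VW; rewrite (mDI cV (cW i)); apply: lerD.
  by apply: m_le; [exact: CylI|exact: cW|exact: subIsetr].
apply: ih; first by apply: CylI => //; exact/CylC/cW.
by move=> x [Vx nWx]; have [|] := VW x Vx.
Qed.

(** Members of [Cyl] are clopen, hence compact, so finitely many basic sets cover [V]. Those chosen
    inside the same [U i] are merged into one [W i], which keeps the indexing by [I]. *)
Let finite_refinement (I : choiceType) (U : I -> set X) V :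
  Cyl V -> (forall i, open (U i)) -> V `<=` \bigcup_i U i ->
  exists s : seq I, exists W : I -> set X,
    [/\ forall i, Cyl (W i), forall i, W i `<=` U i &
        V `<=` \big[setU/set0]_(i <- s) W i].
Proof.
move=> cV oU VU.
have [->|/set0P[x0 Vx0]] := eqVneq V set0.
  by exists [::], (fun=> set0); split=> [i|i|]; [exact: Cyl0|exact: sub0set|
    exact: sub0set].
have [i0 _ _] := VU _ Vx0.
(* Off [V] the pair [(i0, set0)] is a filler that makes the choice function total; the index [i0]
   exists because [V] is nonempty here. *)
have ch (x : X) : exists iW : I * set X,
    V x -> [/\ Cyl iW.2, iW.2 x & iW.2 `<=` U iW.1].
  have [Vx|nVx] := pselect (V x); last by exists (i0, set0).
  have [i _ Uix] := VU _ Vx.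
  have [W [cW Wx WU]] := Cyl_base (open_nbhs_nbhs (conj (oU i) Uix)).
  by exists (i, W).
have [c cP] := choice ch.
have Vcpt : cover_compact V.
  rewrite -compact_cover; apply: (subclosed_compact _ X_compact) => //.
  by rewrite -(setCK V); apply/open_closedC/Cyl_open/CylC.
have [| |D' DV VD] := Vcpt X V (fun x => (c x).2).
- by move=> x /cP[+ _ _] => /Cyl_open.
- by move=> x Vx; exists x => //; have [] := cP _ Vx.
pose r : seq X := finmap.enum_fset D'.
pose W i := \big[setU/set0]_(x <- r | (c x).1 == i) (c x).2.
exists [seq (c x).1 | x <- r], W; split=> [i|i|y Vy].
- rewrite /W big_seq_cond; elim/big_ind: _ => // x /andP[/DV/set_mem/cP[]] //.
- rewrite /W big_seq_cond; elim/big_ind: _ => // [A B ? ?|x].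
    by rewrite subUset.
  by move=> /andP[/DV/set_mem/cP[_ _ +]] /eqP <-.
- have [x /= xD cxy] := VD _ Vy.
  rewrite big_map -bigcup_seq; exists x => //.
  by rewrite /W -bigcup_seq_cond; exists x => //=; rewrite xD eqxx.
Qed.

Local Open Scope ereal_scope.

(** Two-step extension: [lam] is the inner content generated by [m], and [mustar] the outer measure
    obtained from [lam] on open sets. *)
Let lam U : \bar R := ereal_sup [set (m V)%:E | V in [set V | Cyl V /\ V `<=` U]].

Let mustar A : \bar R := ereal_inf [set lam U | U in [set U | open U /\ A `<=` U]].

Let lam_ge0 U : 0 <= lam U.
Proof.
by apply: ereal_sup_ubound; exists set0; [split => //; exact: sub0set|rewrite m0].
Qed.

Let le_lam U U' : U `<=` U' -> lam U <= lam U'.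
Proof.
move=> UU'; apply: ereal_sup_le => _ [V [cV VU] <-].
by exists V => //; split=> //; exact: subset_trans UU'.
Qed.

Let lam_Cyl V : Cyl V -> lam V = (m V)%:E.
Proof.
move=> cV; apply/eqP; rewrite eq_le; apply/andP; split; last first.
  by apply: ereal_sup_ubound; exists V => //; split.
by apply: ge_ereal_sup => _ [W [cW WV] <-]; rewrite lee_fin m_le.
Qed.

Let lam_fin U : lam U \is a fin_num.
Proof.
rewrite ge0_fin_numE //; apply: le_lt_trans (ltry (m setT)).
by rewrite -lam_Cyl //; exact: le_lam.
Qed.

(** Compactness replaces countable additivity of [m]: a member of [Cyl] inside the union is covered
    by finitely many members of [Cyl], each inside one [U n]. *)
Let lam_bigcup (U : (set X)^nat) : (forall n, open (U n)) ->
  lam (\bigcup_n U n) <= \sum_(n <oo) lam (U n).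
Proof.
move=> oU; apply: ge_ereal_sup => _ [V [cV VU] <-].
have [s [W [cW WU VW]]] := finite_refinement cV oU VU.
have [N sN] : exists N, forall i, i \in s -> (i < N)%N.
  exists (\max_(i <- s) i).+1 => i si; rewrite ltnS.
  by rewrite (big_rem i) //= leq_maxl.
apply: (@le_trans _ _ (\sum_(0 <= i < N) (m (W i))%:E)).
  rewrite sumEFin lee_fin; apply: m_subadd => // y /VW.
  rewrite -!bigcup_seq => -[i si Wi]; exists i => //=.
  by rewrite mem_index_iota sN.
apply: (@le_trans _ _ (\sum_(0 <= i < N) lam (U i))); last first.
  by apply: nneseries_lim_ge => n _ _.
by apply: lee_sum => i _; rewrite -lam_Cyl //; apply: le_lam.
Qed.

Let mustar_open U : open U -> mustar U = lam U.
Proof.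
move=> oU; apply/eqP; rewrite eq_le; apply/andP; split.
  by apply: ereal_inf_lbound; exists U => //; split.
by apply: le_ereal_inf_tmp => _ [U' [_ UU'] <-]; exact: le_lam.
Qed.

Let mustar0 : mustar set0 = 0.
Proof. by rewrite mustar_open ?lam_Cyl ?m0 //; exact: open0. Qed.

Let mustar_ge0 A : 0 <= mustar A.
Proof. by apply: le_ereal_inf_tmp => _ [U _ <-]. Qed.

Let le_mustar : {homo mustar : A B / A `<=` B >-> A <= B}.
Proof.
move=> A B AB; apply: le_ereal_inf_tmp => _ [U [oU BU] <-].
by apply: ereal_inf_lbound; exists U => //; split=> //; exact: subset_trans BU.
Qed.

Let mustar_fin A : mustar A \is a fin_num.
Proof.
rewrite ge0_fin_numE //; apply: le_lt_trans (ltry (m setT)).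
by rewrite -lam_Cyl // -mustar_open //; [exact: le_mustar|exact: openT].
Qed.

Let mustar_outer_regular A (e : R) : (0 < e)%R ->
  exists U, [/\ open U, A `<=` U & mustar U <= mustar A + e%:E].
Proof.
move=> e0; have [_ [U [oU AU] <-] lt] := lb_ereal_inf_adherent e0 (mustar_fin A).
by exists U; split=> //; rewrite mustar_open //; exact: ltW.
Qed.

Let mustar_sigma_subadditive : sigma_subadditive mustar.
Proof.
move=> A; apply/lee_addgt0Pr => e e0.
apply: le_trans (epsilon_trick xpredT (fun n => mustar_ge0 (A n)) (ltW e0)).
have ch n : exists U, [/\ open U, A n `<=` U &
    mustar U <= mustar (A n) + (e / (2 ^ n.+1)%:R)%:E].
  by apply: mustar_outer_regular; rewrite divr_gt0 // ltr0n expn_gt0.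
have [U UP] := choice ch.
apply: (@le_trans _ _ (mustar (\bigcup_n U n))).
  by apply/le_mustar/subset_bigcup => n _; have [] := UP n.
rewrite mustar_open; last by apply: bigcup_open => n _; have [] := UP n.
apply: (le_trans (lam_bigcup _)); first by move=> n; have [] := UP n.
apply: lee_nneseries => [n _ _ //|n _].
by have [oU _ le] := UP n; rewrite -mustar_open.
Qed.

Let mu : {outer_measure set X -> \bar R} :=
  HB.pack mustar (isOuterMeasure.Build R X mustar mustar0 mustar_ge0 le_mustar
    mustar_sigma_subadditive).

(** Take an open [Q] around [A] of nearly the same measure and [V] in [Cyl] nearly exhausting [Q]
    inside [U]. The open set [Q] minus [V] contains [A] minus [U], and its content plus [m V] is at
    most that of [Q]. *)
Let mu_open_caratheodory U : open U -> mu.-caratheodory U.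
Proof.
move=> oU; apply: le_caratheodory_measurable => A.
apply/lee_addgt0Pr => e e0; have e20 : (0 < e / 2)%R by rewrite divr_gt0.
have [Q [oQ AQ le]] := mustar_outer_regular A e20.
have [_ [V [cV VQU] <-] ltV] := ub_ereal_sup_adherent e20 (lam_fin (Q `&` U)).
have oQV : open (Q `&` ~` V) by apply: openI => //; exact/Cyl_open/CylC.
have h1 : mustar (A `&` U) <= (m V)%:E + (e / 2)%:E.
  apply: (@le_trans _ _ (lam (Q `&` U))).
    by rewrite -mustar_open; [apply: le_mustar; exact: setSI|exact: openI].
  by rewrite -leeBlDr //; exact: ltW.
have h2 : mustar (A `&` ~` U) <= lam (Q `&` ~` V).
  rewrite -mustar_open //; apply: le_mustar; apply: setISS => //.
  by apply: subsetC => x /VQU[].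
have h3 : (m V)%:E + lam (Q `&` ~` V) <= lam Q.
  rewrite addeC -leeBrDr //; apply: ge_ereal_sup => _ [W [cW WQV] <-].
  rewrite leeBrDr // -EFinD addrC -mU //; last first.
    by rewrite -subset0 => x [Vx /WQV[_]].
  apply: ereal_sup_ubound; exists (V `|` W) => //; split; first exact: CylU.
  by rewrite subUset; split=> x; [move/VQU=> []|move/WQV=> []].
apply: (le_trans (leeD h1 h2)).
have -> : mu A + e%:E = mustar A + (e / 2)%:E + (e / 2)%:E.
  by rewrite -addeA -EFinD -splitr.
rewrite addeAC leeD2r //; apply: le_trans le.
by rewrite mustar_open.
Qed.

(** The index type may be uncountable: compactness leaves finitely many null pieces below each
    member of [Cyl]. This later discards all maps that fail to be characters, for [G] of any
    cardinality. *)
Let mu_null_bigcup (I : choiceType) (U : I -> set X) :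
  (forall i, open (U i)) -> (forall i, mu (U i) = 0) -> mu (\bigcup_i U i) = 0.
Proof.
move=> oU U0; apply/eqP; rewrite eq_le mustar_ge0 andbT [leLHS]mustar_open;
  last by apply: bigcup_open.
apply: ge_ereal_sup => _ [V [cV VU] <-].
have [s [W [cW WU VW]]] := finite_refinement cV oU VU.
apply: (@le_trans _ _ (\sum_(i <- s) (m (W i))%:E)).
  by rewrite sumEFin lee_fin; exact: m_subadd.
rewrite big1 // => i _; apply/eqP; rewrite eq_le; apply/andP; split; last first.
  by rewrite lee_fin m_ge0.
by rewrite -lam_Cyl // -(U0 i) [leRHS]mustar_open //; exact: le_lam.
Qed.

Lemma radon_extension : exists mu : {outer_measure set X -> \bar R},
  [/\ forall V, Cyl V -> mu V = (m V)%:E,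
      forall U, open U -> mu.-caratheodory U,
      forall A (e : R), (0 < e)%R ->
        exists U, [/\ open U, A `<=` U & mu U <= mu A + e%:E] &
      forall (I : choiceType) (U : I -> set X), (forall i, open (U i)) ->
        (forall i, mu (U i) = 0) -> mu (\bigcup_i U i) = 0].
Proof.
exists mu; split=> //.
by move=> V cV; rewrite [LHS]mustar_open ?lam_Cyl //; exact: Cyl_open.
Qed.

End radon_extension.

(** * Masses of cylinders *)

(** The sets containing a box around [x] with finitely many constrained coordinates form a filter.
    The product topology being a supremum, convergence of this filter to [x] is checked one
    coordinate at a time. *)
Lemma ptws_nbhs (I : eqType) (T : topologicalType) (x : {ptws I -> T}) A :
  nbhs x A -> exists S : seq I, exists N : I -> set T,
    (forall i, nbhs (x i) (N i)) /\
    [set z | forall i, i \in S -> N i (z i)] `<=` A.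
Proof.
pose F : set_system {ptws I -> T} := [set A | exists S : seq I, exists N : I -> set T,
    (forall i, nbhs (x i) (N i)) /\
    [set z | forall i, i \in S -> N i (z i)] `<=` A].
have FF : Filter F.
  split.
  - by exists [::], (fun=> setT); split=> // i; exact: filterT.
  - move=> P Q [S [N [xN NP]]] [S' [N' [xN' NQ]]].
    exists (S ++ S'), (fun i => N i `&` N' i); split=> [i|z zN].
      exact: filterI.
    split; [apply: NP => i iS|apply: NQ => i iS];
      by have [] := zN i; rewrite // mem_cat iS ?orbT.
  - by move=> P Q PQ [S [N [xN NP]]]; exists S, N; split=> // z /NP/PQ.
suff : F --> x by apply.
apply/cvg_sup => i B [_ [[P oP <-] /= Px] PB].
exists [:: i], (fun j => if j == i then P else setT).
split=> [j|z /(_ i)]; last by rewrite mem_seq1 eqxx => /(_ isT); exact: PB.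
by case: eqP => [->|_]; [exact: open_nbhs_nbhs|exact: filterT].
Qed.


(** The compact group of all maps from [G] to signs, with [true] for 1 and [false] for -1.
    Characters are singled out only later, by a null-set argument. *)
Definition bspace (G : zmodType) := prod_topology (fun _ : G => bool).
HB.instance Definition _ (G : zmodType) := Pointed.on (bspace G).
HB.instance Definition _ (G : zmodType) := Topological.on (bspace G).

Lemma bspace_compact (G : zmodType) : compact [set: bspace G].
Proof.
have := @tychonoff G (fun=> bool) (fun=> setT) (fun=> bool_compact).
by congr compact; apply/seteqP; split.
Qed.

Section cylinders.
Variable G : zmodType.
Implicit Types (x y z : bspace G) (V W : set (bspace G)) (S : seq G).

Definition determined_by S V := forall x y, {in S, x =1 y} -> V x -> V y.

Definition cylinder : set (set (bspace G)) := [set V | exists S, determined_by S V].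

Lemma determined_byS S S' V : {subset S <= S'} -> determined_by S V ->
  determined_by S' V.
Proof. by move=> SS' dV x y xy; apply: dV => g /SS'/xy. Qed.

Lemma determined_byC S V : determined_by S V -> determined_by S (~` V).
Proof. by move=> dV x y xy nVx Vy; apply/nVx/(dV y) => // g /xy ->. Qed.

Lemma determined_byI S V W :
  determined_by S V -> determined_by S W -> determined_by S (V `&` W).
Proof. by move=> dV dW x y xy [/(dV _ _ xy) ? /(dW _ _ xy)]. Qed.

Lemma determined_byU S V W :
  determined_by S V -> determined_by S W -> determined_by S (V `|` W).
Proof. by move=> dV dW x y xy [/(dV _ _ xy)|/(dW _ _ xy)]; [left|right]. Qed.

Lemma determined_by_coord S g b : g \in S ->
  determined_by S [set x : bspace G | x g = b].
Proof. by move=> gS x y xy /= <-; rewrite xy. Qed.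

Lemma cylinderT : cylinder setT. Proof. by exists [::]. Qed.

Lemma cylinderC V : cylinder V -> cylinder (~` V).
Proof. by move=> [S /determined_byC dV]; exists S. Qed.

Lemma cylinderI V W : cylinder V -> cylinder W -> cylinder (V `&` W).
Proof.
move=> [S dV] [S' dW]; exists (S ++ S'); apply: determined_byI.
  by apply: determined_byS dV => g gS; rewrite mem_cat gS.
by apply: determined_byS dW => g gS; rewrite mem_cat gS orbT.
Qed.

Lemma bspace_nbhs x S : nbhs x [set z : bspace G | {in S, x =1 z}].
Proof.
elim: S => [|g S ih]; first by apply: filterS filterT.
have xg : nbhs x [set z : bspace G | z g = x g].
  have := @proj_continuous G (fun=> bool) g x [set x g].
  by apply; rewrite nbhs_principalE; apply/principal_filterP.
apply: filterS (filterI xg ih) => z [/= zg zS] h.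
by rewrite inE => /predU1P[->//|]; exact: zS.
Qed.

Lemma cylinder_open V : cylinder V -> open V.
Proof.
move=> [S dV]; rewrite openE => x Vx; apply: filterS (bspace_nbhs x S) => z xz.
exact: dV Vx.
Qed.

Lemma cylinder_base x A : nbhs x A -> exists V, [/\ cylinder V, V x & V `<=` A].
Proof.
move=> /ptws_nbhs[S [N [xN NA]]]; exists [set z : bspace G | {in S, x =1 z}]; split=> //.
  by exists S => y z yz xy g gS; rewrite xy ?yz.
move=> z xz; apply: NA => g gS; rewrite -xz //; exact: nbhs_singleton (xN g).
Qed.

End cylinders.

Definition sgb (b : bool) : RR := if b then 1 else -1.

(** Multiplication of signs is equality of booleans; hence multiplicativity is written with [==] in
    [not_mul] and [sign_hom]. *)
Lemma sgbM b c : sgb b * sgb c = sgb (b == c).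
Proof. by case: b; case: c; rewrite /sgb /=; lra. Qed.

Lemma sgb_neg b : sgb (~~ b) = - sgb b.
Proof. by case: b; rewrite /sgb /=; lra. Qed.

(** * Restricting to prescribed values, and the resulting masses *)

Section conditioning.
Variable G : zmodType.
Hypothesis exp2 : forall g : G, g + g = 0.
Implicit Types (phi psi : G -> quat) (g h : G).
Implicit Types (V W : set (bspace G)) (S : seq G).

Lemma exp2_opp g : - g = g.
Proof. by apply/esym/eqP; rewrite -addr_eq0 exp2. Qed.

(* If phi is the transform of a measure on characters, this is the transform of
   its restriction to the characters with value sgb b at g. *)
Definition restr phi g b : G -> quat :=
  fun x => 2^-1 *: (phi x + sgb b *: phi (x + g)).

Lemma restrD phi psi g b :
  restr (fun x => phi x + psi x) g b = fun x => restr phi g b x + restr psi g b x.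
Proof. by apply/funext => x; apply: qcP => n; rewrite /restr !qcE; ring. Qed.

Lemma restr_split phi g : phi = fun x => restr phi g true x + restr phi g false x.
Proof. by apply/funext => x; apply: qcP => n; rewrite /restr /sgb !qcE; lra. Qed.

Lemma restrC phi g h b c : restr (restr phi g b) h c = restr (restr phi h c) g b.
Proof.
apply/funext => x; apply: qcP => n; rewrite /restr (addrAC x g h) !qcE; ring.
Qed.

Lemma restr_id phi g b : restr (restr phi g b) g b = restr phi g b.
Proof.
apply/funext => x; apply: qcP => n; rewrite /restr -addrA exp2 addr0 !qcE.
by case: b; rewrite /sgb; lra.
Qed.

Lemma restr_neg phi g b : restr (restr phi g b) g (~~ b) = fun=> 0.
Proof.
apply/funext => x; apply: qcP => n; rewrite /restr -addrA exp2 addr0 !qcE.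
by case: b; rewrite /sgb /=; lra.
Qed.

Lemma restr0 g b : restr (fun=> 0) g b = fun=> 0.
Proof. by apply/funext => x; rewrite /restr scaler0 addr0 scaler0. Qed.

(** A character with values [b] at [g] and [c] at [h] has their product at [g + h], so prescribing
    the other sign leaves nothing. Algebraically, exponent 2 folds the eight translates into four,
    which cancel. *)
Lemma restr_mul phi g h b c d : d <> (b == c) ->
  restr (restr (restr phi g b) h c) (g + h) d = fun=> 0.
Proof.
move=> dbc; have -> : d = ~~ (b == c) by case: d (b == c) dbc => [] [] //; case.
apply/funext => x; apply: qcP => n; rewrite /restr.
have e1 : x + (g + h) + h = x + g by rewrite -!addrA exp2 addr0.
have e2 : x + (g + h) + g = x + h by rewrite (addrC g) -!addrA exp2 addr0.
have e3 : x + g + g = x by rewrite -addrA exp2 addr0.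
rewrite e1 e2 e3 (addrAC x h g) (addrA x g h) !qcE.
by case: b {dbc}; case: c; rewrite /sgb /=; lra.
Qed.

(** With the real coefficient [sgb b] and [- g = g], the function of [qpos_def_translate] is twice
    [phi x + sgb b *: phi (x + g)]; hence the factor 1/4. *)
Lemma qpos_def_restr phi g b : qpos_def phi -> qpos_def (restr phi g b).
Proof.
move=> hp; have := qpos_defZ (_ : 0 <= 4^-1) (qpos_def_translate (sgb b *: qone) g hp).
have -> : (fun x => 4^-1 *: (phi x
   + qmul (qmul (qconj (sgb b *: qone)) (phi x)) (sgb b *: qone)
   + qmul (phi (x + g)) (sgb b *: qone)
   + qmul (qconj (sgb b *: qone)) (phi (x - g)))) = restr phi g b.
  apply/funext => x; rewrite exp2_opp qconjZ qconj1 !(qmulZl, qmulZr) !qmul1 !qmulr1.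
  apply: qcP => n; rewrite /restr !qcE.
  by case: b; rewrite /sgb; lra.
by apply; rewrite invr_ge0.
Qed.

Implicit Types x y : bspace G.

Definition upd x g b : bspace G := fun h => if h == g then b else x h.

(* Sums over the sign patterns on S; x only supplies the values off S, which do
   not matter when V is determined by S. *)
Fixpoint mass V S phi x : RR :=
  if S is g :: S' then
    mass V S' (restr phi g true) (upd x g true) +
    mass V S' (restr phi g false) (upd x g false)
  else qc (phi 0) 0 * (x \in V)%:R.

Lemma mass_ge0 V S phi x : qpos_def phi -> 0 <= mass V S phi x.
Proof.
elim: S phi x => [|g S ih] phi x hp /=.
  by apply: mulr_ge0 => //; have [] := qpos_def0 hp.
by apply: addr_ge0; apply/ih/qpos_def_restr.
Qed.

Lemma massD V S phi psi x :
  mass V S (fun k => phi k + psi k) x = mass V S phi x + mass V S psi x.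
Proof.
elim: S phi psi x => [|g S ih] phi psi x /=; first by rewrite qcE mulrDl.
by rewrite !restrD !ih addrACA.
Qed.

Lemma mass0 V S x : mass V S (fun=> 0) x = 0.
Proof.
by elim: S x => [|g S ih] x /=; rewrite ?qcE ?mul0r // !restr0 !ih addr0.
Qed.

Lemma mass_setU V W S phi x : V `&` W = set0 ->
  mass (V `|` W) S phi x = mass V S phi x + mass W S phi x.
Proof.
move=> VW; elim: S phi x => [|g S ih] phi x /=; last by rewrite !ih addrACA.
rewrite -mulrDr in_setU; congr (_ * _); rewrite -natrD; congr (_%:R).
case: (boolP (x \in V)) => //= xV; case: (boolP (x \in W)) => //= xW.
by have : (V `&` W) x; [split; exact: set_mem|rewrite VW].
Qed.

(** [P] serves the induction: it collects the coordinates that [upd] has already overwritten, on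
    which the two starting points agree. *)
Lemma mass_start V S P phi x y : determined_by (P ++ S) V -> {in P, x =1 y} ->
  mass V S phi x = mass V S phi y.
Proof.
elim: S P phi x y => [|g S ih] P phi x y dV xy /=.
  rewrite cats0 in dV; suff -> : (x \in V) = (y \in V) by [].
  by apply/idP/idP => /set_mem Vx; apply/mem_set; apply: dV Vx => // g /xy ->.
have dV' : determined_by ((g :: P) ++ S) V.
  by apply: determined_byS dV => h; rewrite !(mem_cat, inE) orbCA orbA.
by congr (_ + _); apply: (ih (g :: P)) => // h; rewrite inE /upd => /predU1P[->|/xy ->];
  rewrite ?eqxx.
Qed.

(** [V] does not see the value written at [g] unless [S] rewrites it, and the two restrictions add
    up to [phi]. *)
Lemma mass_cons V S g phi x : determined_by S V ->
  mass V (g :: S) phi x = mass V S phi x.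
Proof.
move=> dV /=; rewrite [in RHS](restr_split phi g) massD.
by congr (_ + _); apply: (@mass_start _ _ [::]).
Qed.

Lemma mass_cat V S S' phi x : determined_by S V ->
  mass V (S' ++ S) phi x = mass V S phi x.
Proof.
move=> dV; elim: S' => //= g S' <-; apply: (mass_cons g).
by apply: determined_byS dV => h hS; rewrite mem_cat hS orbT.
Qed.

Lemma mass_swap V S g h phi x :
  mass V [:: g, h & S] phi x = mass V [:: h, g & S] phi x.
Proof.
have [->//|gh] := eqVneq g h.
have updC b c : upd (upd x g b) h c = upd (upd x h c) g b.
  by apply/funext => k; rewrite /upd; case: eqP => // ->; case: eqP => // hg;
    rewrite hg eqxx in gh.
by rewrite /= !(restrC _ g h) !updC addrACA.
Qed.

Lemma mass_move V S S' g phi x :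
  mass V (S ++ g :: S') phi x = mass V (g :: S ++ S') phi x.
Proof.
elim: S phi x => // h S ih phi x.
by rewrite (mass_swap V (S ++ S') g h); rewrite /= -/cat !ih.
Qed.

Lemma mass_catC V S S' phi x : mass V (S ++ S') phi x = mass V (S' ++ S) phi x.
Proof.
elim: S S' phi x => [|g S ih] S' phi x; first by rewrite cats0.
by rewrite mass_move /= !ih.
Qed.

(** Both sides equal the mass over the concatenation of the two lists, whose order is immaterial. *)
Lemma mass_indep V S S' phi x y : determined_by S V -> determined_by S' V ->
  mass V S phi x = mass V S' phi y.
Proof.
move=> dS dS'; rewrite -(mass_cat S' _ _ dS) mass_catC mass_cat //.
exact: (@mass_start _ _ [::]).
Qed.

(** On cylinders neither the chosen list nor the starting point matters, by [mass_indep]. On other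
    sets the list defaults to [[::]] and the value has no meaning. *)
Definition cmass phi V : RR :=
  mass V (xget [::] [set S | determined_by S V]) phi (fun=> true).

Lemma cmassE phi V S x : determined_by S V -> cmass phi V = mass V S phi x.
Proof.
move=> dV; apply: mass_indep => //.
by case: xgetP => [_ _ //|/(_ S)].
Qed.

Lemma cmass_ge0 phi V : qpos_def phi -> 0 <= cmass phi V.
Proof. exact: mass_ge0. Qed.

Lemma cmassU phi V W : cylinder V -> cylinder W -> V `&` W = set0 ->
  cmass phi (V `|` W) = cmass phi V + cmass phi W.
Proof.
move=> [S dV] [S' dW] VW; pose x : bspace G := fun=> true.
have dV' : determined_by (S ++ S') V.
  by apply: determined_byS dV => g gS; rewrite mem_cat gS.
have dW' : determined_by (S ++ S') W.
  by apply: determined_byS dW => g gS; rewrite mem_cat gS orbT.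
by rewrite (cmassE phi x dV') (cmassE phi x dW')
  (cmassE phi x (determined_byU dV' dW')) mass_setU.
Qed.

Lemma cmassT phi : cmass phi setT = qc (phi 0) 0.
Proof. by rewrite (@cmassE _ _ [::] (fun=> true)) //= in_setT mulr1. Qed.

Lemma cmass0 V : cmass (fun=> 0) V = 0.
Proof. exact: mass0. Qed.

(** With [g] placed last in the list, the restriction at [g] commutes past all the others, and the
    claim reduces to the list [[:: g]], where [restr_id] and [restr_neg] settle it. *)
Lemma cmass_restr phi V g b : cylinder V ->
  cmass (restr phi g b) V = cmass phi (V `&` [set x | x g = b]).
Proof.
move=> [S dV]; pose x : bspace G := fun=> true.
have dV' : determined_by (S ++ [:: g]) V.
  by apply: determined_byS dV => h hS; rewrite mem_cat hS.
have dVb : determined_by (S ++ [:: g]) (V `&` [set x | x g = b]).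
  apply: determined_byI => //; apply: determined_by_coord.
  by rewrite mem_cat mem_seq1 eqxx orbT.
rewrite (cmassE _ x dV') (cmassE _ x dVb) {dV dV' dVb}.
elim: S phi x => [|h S ih] phi x; last by rewrite /= !(restrC _ g h) !ih.
have upd_in c : (upd x g c \in V `&` [set x | x g = b]) =
    (upd x g c \in V) && (c == b).
  rewrite in_setI; congr (_ && _).
  by apply/idP/eqP => [/set_mem|<-]; last apply/mem_set; rewrite /= /upd eqxx.
rewrite /= !upd_in.
case: b upd_in => _; rewrite restr_id.
  by rewrite (restr_neg phi g true) qcE mul0r !andbF andbT mulr0.
by rewrite (restr_neg phi g false) qcE mul0r !andbF andbT mulr0.
Qed.

Lemma cmass_split phi V g : cmass phi V =
  cmass (restr phi g true) V + cmass (restr phi g false) V.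
Proof. by rewrite /cmass -massD -restr_split. Qed.

Lemma cmass_coord phi g b :
  cmass phi [set x | x g = b] = qc (restr phi g b 0) 0.
Proof.
by rewrite -cmassT cmass_restr ?setTI //; exact: cylinderT.
Qed.

Definition not_mul g h : set (bspace G) := [set x | x (g + h) <> (x g == x h)].

Lemma cylinder_not_mul g h : cylinder (not_mul g h).
Proof.
exists [:: g; h; g + h] => x y xy; rewrite /not_mul /= => nx.
by rewrite -!xy // !inE eqxx ?orbT.
Qed.

(** Split by the values [b], [c], [d] at [g], [h], [g + h]. If [d] is the product of [b] and [c], no
    point of the set has these values; otherwise the triple restriction of [phi] is 0. *)
Lemma cmass_not_mul phi g h : cmass phi (not_mul g h) = 0.
Proof.
have cN := cylinder_not_mul g h.
have piece b c d :
    cmass (restr (restr (restr phi g b) h c) (g + h) d) (not_mul g h) = 0.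
  have [dbc|dbc] := eqVneq d (b == c); last first.
    by rewrite restr_mul ?cmass0 //; apply/eqP.
  have cI V k e : cylinder V -> cylinder (V `&` [set x : bspace G | x k = e]).
    move=> cV; apply: cylinderI => //; exists [:: k].
    by apply: determined_by_coord; rewrite mem_seq1.
  rewrite cmass_restr // cmass_restr; last exact: cI.
  rewrite cmass_restr; last by do 2 apply: (cI).
  rewrite (_ : _ `&` _ = set0) -?(cmass0 set0).
    rewrite (@cmassE _ _ [::] (fun=> true)) // (@cmassE (fun=> 0) _ [::] (fun=> true)) //=.
    by rewrite in_set0 !mulr0.
  rewrite -subset0 => x [[[nx /= xd] xc] xb]; apply: nx.
  by rewrite xd xc xb.
have piece2 b c : cmass (restr (restr phi g b) h c) (not_mul g h) = 0.
  by rewrite (cmass_split _ _ (g + h)) !piece addr0.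
have piece1 b : cmass (restr phi g b) (not_mul g h) = 0.
  by rewrite (cmass_split _ _ h) !piece2 addr0.
by rewrite (cmass_split _ _ g) !piece1 addr0.
Qed.

End conditioning.

(** * Compactness and extreme points *)

Lemma lincomb_continuous (R : realType) (T : topologicalType) (I : Type)
    (s : seq I) (c : I -> R) (l : I -> T -> R) : (forall i, continuous (l i)) ->
  continuous (fun y => \sum_(i <- s) l i y * c i).
Proof.
move=> cl y; elim: s => [|i s ih].
  by rewrite (_ : (fun _ => _) = cst 0) ?big_nil; [exact: cvg_cst|
    apply/funext => z; rewrite big_nil].
rewrite (_ : (fun _ => _) = (fun z => l i z * c i + \sum_(i <- s) l i z * c i)).
  by apply: cvgD; [apply: cvgMl; exact: cl|exact: ih].
by apply/funext => z; rewrite big_cons.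
Qed.

Section Pstar_topology.
Variable G : zmodType.

Lemma qspace_hausdorff : hausdorff_space (qspace G).
Proof. by apply: hausdorff_product => g; exact: norm_hausdorff. Qed.

Lemma Pstar_convex : convex_set_q (Pstar G).
Proof.
move=> y z t [hy y0] [hz z0] /andP[t0 t1]; split.
  by apply: qpos_defD; apply: qpos_defZ => //; rewrite subr_ge0.
by rewrite /ccomb y0 z0 -scalerDl addrC subrK scale1r.
Qed.

(** Expanding the values of [phi] in the standard basis makes the form a finite combination of
    coordinates [l t] with constant coefficients [c t]. *)
Lemma qform_continuous k (g : 'I_k -> G) (q : 'I_k -> quat) n :
  continuous (fun phi : qspace G => qc (\sum_(i < k) \sum_(j < k)
    qmul (qmul (qconj (q i)) (phi (g j - g i))) (q j)) n : RR).
Proof.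
pose idx := allpairs (fun ij m => (ij, m)) (allpairs pair (enum 'I_k) (enum 'I_k))
  (enum 'I_4).
pose c (t : 'I_k * 'I_k * 'I_4) : RR :=
  qc (qmul (qmul (qconj (q t.1.1)) (delta_mx 0 t.2)) (q t.1.2)) n.
pose l (t : 'I_k * 'I_k * 'I_4) (phi : qspace G) : RR :=
  phi (g t.1.2 - g t.1.1) ord0 t.2.
have cl t : continuous (l t).
  move=> phi; apply: (@continuous_comp (qspace G) quat RR
    (fun y => y (g t.1.2 - g t.1.1)) (fun q => q ord0 t.2)).
    exact: qspace_eval_continuous.
  exact: coord_continuous.
have := @lincomb_continuous (RR : realType) (qspace G) _ idx c l cl.
rewrite (_ : (fun y => _) = fun phi : qspace G => qc (\sum_(i < k) \sum_(j < k)
  qmul (qmul (qconj (q i)) (phi (g j - g i))) (q j)) n) //.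
apply/funext => phi; rewrite big_allpairs big_allpairs big_enum /=.
rewrite qc_sum; apply: eq_bigr => i _; rewrite qc_sum big_enum; apply: eq_bigr => j _.
rewrite big_enum [in RHS](row_sum_delta (phi (g j - g i))).
by rewrite qmul_sumr qmul_suml qc_sum; apply: eq_bigr => m _;
    rewrite qmulZr qmulZl qcZ.
Qed.

Lemma Pstar_closed : closed (Pstar G : set (qspace G)).
Proof.
have closed_pre (l : qspace G -> RR) (D : set RR) :
    continuous l -> closed D -> closed (l @^-1` D).
  by move=> cl cD; apply: closed_comp => // y _; exact: cl.
rewrite (_ : Pstar G = [set phi | qpos_def phi] `&` [set phi | phi 0 = qone]) //.
apply: closedI; last first.
  rewrite (_ : [set phi | _] = \bigcap_n
      ((fun phi : qspace G => qc (phi 0) n : RR) @^-1` [set qc qone n])).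
    apply: closed_bigI => n _; apply: closed_pre; last exact: closed_eq.
    exact: qspace_coord_continuous.
  apply/seteqP; split=> [phi /= h n _|phi h]; first by rewrite /= h.
  by apply: qcP => n; exact: h.
rewrite (_ : [set phi | _] = \bigcap_(k : nat) \bigcap_(g : 'I_k -> G)
    \bigcap_(q : 'I_k -> quat) [set phi : qspace G | qnonneg_real (\sum_(i < k)
      \sum_(j < k) qmul (qmul (qconj (q i)) (phi (g j - g i))) (q j))]).
  apply: closed_bigI => k _; apply: closed_bigI => g _; apply: closed_bigI => q _.
  pose l n := fun phi : qspace G => qc (\sum_(i < k) \sum_(j < k)
    qmul (qmul (qconj (q i)) (phi (g j - g i))) (q j)) n : RR.
  rewrite (_ : [set phi | _] = (l 0 @^-1` [set x | 0 <= x]) `&`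
    ((l 1 @^-1` [set 0]) `&` ((l 2 @^-1` [set 0]) `&` (l 3 @^-1` [set 0])))).
    have cl n : continuous (l n) by exact: qform_continuous.
    have c0 n : closed (l n @^-1` [set 0]).
      by apply: closed_pre => //; exact: closed_eq.
    apply: closedI; last by apply: closedI => //; exact: closedI.
    by apply: closed_pre => //; exact: closed_ge.
  by apply/seteqP; split=> phi /= [] // ? [? [? ?]]; split.
by apply/seteqP; split=> [phi h k _ g _ q _|phi h k g q]; [exact: h|exact: h k I g I q I].
Qed.

(** By [qpos_def_norm] this closed set lies in a product of cubes, which is compact by Tychonoff. *)
Lemma Pstar_compact : compact (Pstar G : set (qspace G)).
Proof.
pose B : set quat := [set q | forall i, (`[-1, 1]%classic : set RR) (q ord0 i)].
have Bc : compact B := @rV_compact RR 4 _ (fun=> @segment_compact (RR : realType) (-1) 1).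
have Tc := @tychonoff G (fun=> quat) (fun=> B) (fun=> Bc).
apply: (@subclosed_compact (qspace G) _ _ Pstar_closed Tc).
move=> phi [hp h0] g i /=; rewrite in_itv /= -ler_norml.
have := qpos_def_norm g hp; rewrite h0 /qone qcE expr1n.
rewrite -(inord_val i) -[phi g ord0 (inord i)]/(qc (phi g) i) => le1.
rewrite -(ler_pXn2r (n := 2)) // ?nnegrE // expr1n real_normK ?num_real //.
by apply: le_trans le1; case: i => [[|[|[|[|]]]]] //= _; nra.
Qed.

End Pstar_topology.

(** * Characters as the extreme points *)

Section characters.
Variable G : zmodType.

Definition bembed (x : bspace G) : qspace G := fun g => sgb (x g) *: qone.

Definition sign_hom : set (bspace G) :=
  [set x : bspace G | forall g h, x (g + h) = (x g == x h)].

Lemma qc_bembed (x : bspace G) g : qc (bembed x g) 0 = sgb (x g).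
Proof. by rewrite /bembed /qone !qcE mulr1. Qed.

Lemma sgb_inj : injective sgb.
Proof. by case; case; rewrite /sgb // => ?; exfalso; lra. Qed.

Lemma bembed_continuous : continuous bembed.
Proof.
move=> x A /ptws_nbhs[S [N [xN NA]]].
apply: filterS (bspace_nbhs x S) => z xz; apply: NA => g gS.
by rewrite /bembed -xz //; exact: nbhs_singleton (xN g).
Qed.

Lemma sign_hom_bigcap : sign_hom = ~` \bigcup_(gh : G * G) not_mul gh.1 gh.2.
Proof.
apply/seteqP; split=> [x hx [[g h] _]|x nx g h]; first by apply; exact: hx.
by apply: contrapT => ngh; apply: nx; exists (g, h).
Qed.

Lemma sign_hom_closed : closed sign_hom.
Proof.
rewrite sign_hom_bigcap; apply: open_closedC; apply: bigcup_open => -[g h] _.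
exact/cylinder_open/cylinder_not_mul.
Qed.

Lemma bembed_closed (A : set (bspace G)) : closed A -> closed (bembed @` A).
Proof.
move=> cA; apply: (compact_closed (@qspace_hausdorff G)).
apply: continuous_compact; last exact: subclosed_compact cA (@bspace_compact G) _.
by apply: continuous_subspaceT; exact: bembed_continuous.
Qed.

Hypothesis exp2 : forall g : G, g + g = 0.

Lemma qpos_def_real (phi : G -> quat) g :
  qpos_def phi -> phi g = qc (phi g) 0 *: qone.
Proof.
move=> /qpos_def_conj-/(_ g); rewrite exp2_opp // => hc.
have h1 : qc (phi g) 1 = - qc (phi g) 1 by rewrite {1}hc qcE.
have h2 : qc (phi g) 2 = - qc (phi g) 2 by rewrite {1}hc qcE.
have h3 : qc (phi g) 3 = - qc (phi g) 3 by rewrite {1}hc qcE.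
by apply: qext; rewrite /qone !qcE; lra.
Qed.

Lemma qpos_def_le (phi : G -> quat) g : qpos_def phi ->
  - qc (phi 0) 0 <= qc (phi g) 0 <= qc (phi 0) 0.
Proof.
move=> hp; have [h _ _ _] := qpos_def0 hp.
rewrite -ler_norml -[leRHS]ger0_norm // -ler_sqr ?nnegrE // !real_normK ?num_real //.
by apply: le_trans (qpos_def_norm g hp); nra.
Qed.

(** For a character the form is the square of the norm of the sum of the [sgb (x (g i)) *: q i]. *)
Lemma Pstar_bembed x : sign_hom x -> Pstar G (bembed x).
Proof.
move=> hx; split; last first.
  by rewrite /bembed -[X in x X](addr0 0) hx eqxx scale1r.
move=> k g q; have := qnonneg_real_sqr (\sum_(i < k) sgb (x (g i)) *: q i).
congr qnonneg_real; rewrite qconj_sum qmul_suml; apply: eq_bigr => i _.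
rewrite qmul_sumr; apply: eq_bigr => j _.
rewrite /bembed exp2_opp // hx -sgbM qconjZ !(qmulZl, qmulZr) qmulr1.
by rewrite ?scalerA; congr (_ *: _); rewrite mulrC.
Qed.

(** Characters are extreme because 1 and -1 are the endpoints of the interval of possible values.
    Conversely, a value strictly between them splits [phi] into its two normalized restrictions. *)
Lemma ext_boundary_Pstar : ext_boundary (Pstar G) = bembed @` sign_hom.
Proof.
apply/seteqP; split=> [phi [[hp h0] ephi]|_ [x hx <-]]; last first.
  split; first exact: Pstar_bembed.
  move=> y z t [hy y0] [hz z0] /andP[t0 t1] xyz.
  suff key g : qc (y g) 0 = sgb (x g) /\ qc (z g) 0 = sgb (x g).
    by split; apply/funext => g; rewrite [LHS]qpos_def_real //;
      have [y1 z1] := key g; rewrite ?y1 ?z1.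
  have := qpos_def_le g hy; have := qpos_def_le g hz.
  rewrite y0 z0 /qone !qcE => /andP[z1 z2] /andP[y1 y2].
  have := congr1 (fun f => qc (f g) 0) xyz; rewrite qc_bembed /ccomb !qcE.
  move: (qc (y g) 0) (qc (z g) 0) y1 y2 z1 z2 => a b a1 a2 b1 b2 e.
  by case: (x g) e; rewrite /sgb => e; split; nra.
have qc00 : qc (phi 0) 0 = 1 by rewrite h0 /qone qcE.
have mass1 g b : qc (restr phi g b 0) 0 = (1 + sgb b * qc (phi g) 0) / 2.
  by rewrite /restr add0r !qcE qc00 mulrC.
have sgn g : exists b, qc (phi g) 0 = sgb b.
  have le1 := qpos_def_le g hp; rewrite qc00 in le1.
  apply: contrapT => nb.
  pose t := qc (restr phi g true 0) 0; pose s := qc (restr phi g false 0) 0.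
  have tE := mass1 g true; have sE := mass1 g false.
  have f1 : qc (phi g) 0 != 1 by apply: contra_notN nb => /eqP ->; exists true.
  have f2 : qc (phi g) 0 != -1 by apply: contra_notN nb => /eqP ->; exists false.
  have {}f2 : -1 < qc (phi g) 0 by rewrite lt_neqAle eq_sym f2; case/andP: le1.
  have lt1 : qc (phi g) 0 < 1 by rewrite lt_neqAle f1; case/andP: le1.
  have t0 : 0 < t by rewrite /t tE /sgb; lra.
  have s0 : 0 < s by rewrite /s sE /sgb; lra.
  have ts : t + s = 1 by rewrite /t /s tE sE /sgb; lra.
  have inP b : 0 < qc (restr phi g b 0) 0 ->
      Pstar G (fun h => (qc (restr phi g b 0) 0)^-1 *: restr phi g b h).
    move=> r0; split; last first.
      rewrite {2}(qpos_def_real 0 (qpos_def_restr exp2 g b hp)) scalerA.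
      by rewrite mulVf ?scale1r // gt_eqF.
    by apply: qpos_defZ; [rewrite invr_ge0 ltW|exact: qpos_def_restr].
  have [||] := ephi _ _ t (inP true t0) (inP false s0).
  - lra.
  - apply/funext => h; rewrite /ccomb (_ : 1 - t = s); last by lra.
    rewrite !scalerA !mulfV ?gt_eqF // !scale1r.
    by apply: qcP => n; rewrite /sgb !qcE; lra.
  (* Extremality identifies [phi] with its normalized restriction to the value 1 at [g]; that
     function equals 1 at [g], contrary to [f1]. *)
  move=> + _ => /(congr1 (fun f => qc (f g) 0)); rewrite -/t qcE /restr exp2 !qcE.
  rewrite qc00 => e; move: f1; rewrite -{}e => /eqP; apply.
  have -> : 2^-1 * (qc (phi g) 0 + sgb true * 1) = t by rewrite /t tE /sgb; lra.
  by rewrite mulVf // gt_eqF.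
have [x xP] := choice sgn; exists x => [g h|]; last first.
  by apply/funext => g; rewrite /bembed -xP -qpos_def_real.
(* The restriction to the sign opposite to [x g] has value 0 at 0, so the norm bound makes it
   vanish. At [h] this says that [phi (g + h)] is the product of [phi g] and [phi h]. *)
have rz : restr phi g (~~ x g) = fun=> 0.
  have hr := qpos_def_restr exp2 g (~~ x g) hp.
  have r0 : qc (restr phi g (~~ x g) 0) 0 = 0.
    by rewrite mass1 xP sgb_neg mulNr sgbM eqxx /sgb; lra.
  apply/funext => k; rewrite (qpos_def_real k hr).
  have := qpos_def_le k hr; rewrite r0 oppr0 => /le_anti <-.
  by rewrite scale0r.
apply: sgb_inj; rewrite -sgbM -!xP.
have := congr1 (fun f => qc (f h) 0) rz; rewrite /restr !qcE sgb_neg (addrC h).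
by rewrite (xP g); case: (x g); rewrite /sgb; lra.
Qed.

End characters.

(** * Existence of representing measures *)

Section continuous_linear_functionals.
Variable G : zmodType.

(** Continuity at 0 bounds [l] by 1 on all functions vanishing on some finite [S]. Scaling then
    forces [l] to vanish on them, so [l y] depends only on the values of [y] on [S]. *)
Lemma cont_lin_functional_finite (l : qspace G -> RR) : cont_lin_functional l ->
  exists S : seq G, exists a : G -> RR, forall y : G -> quat,
    (forall g, y g = qc (y g) 0 *: qone) ->
    l y = \sum_(g <- S) a g * qc (y g) 0.
Proof.
move=> [cl ll].
have l0 : l (fun=> 0) = 0.
  by have := ll 1 (fun=> 0) (fun=> 0); rewrite scale1r addr0; lra.
have lD u v : l (fun g => u g + v g) = l u + l v.
  rewrite -[l u]mul1r -ll; congr l; apply/funext => g; by rewrite scale1r.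
have lZ t u : l (fun g => t *: u g) = t * l u.
  have := ll t u (fun=> 0); rewrite l0 addr0 => <-.
  by congr l; apply/funext => g; rewrite addr0.
have [S [N [N0 NS]]] : exists S : seq G, exists N : G -> set quat,
    (forall g, nbhs (0 : quat) (N g)) /\
    [set z | forall g, g \in S -> N g (z g)] `<=` [set z | `|l z| < 1].
  apply: (@ptws_nbhs G quat (fun=> 0)).
  have n0 : nbhs (l (fun=> 0)) [set r : RR | `|r| < 1].
    by rewrite l0; exact: (@nbhs0_lt (RR : realType) (RR : realType) 1 ltr01).
  exact: (cl _ _ n0).
have vanish z : (forall g, g \in S -> z g = 0) -> l z = 0.
  move=> zS; apply/eqP; apply: contraT => lz0.
  have := NS (fun g => (l z)^-1 *: z g) => /=.
  rewrite lZ mulVf // normr1 ltxx; apply.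
  by move=> g /zS ->; rewrite scaler0; exact: nbhs_singleton.
pose e g : G -> quat := fun h => if h == g then qone else 0.
exists (undup S), (fun g => l (e g)) => y yreal.
have lsum (s : seq G) : l (fun h => \sum_(g <- s) qc (y g) 0 *: e g h) =
    \sum_(g <- s) l (e g) * qc (y g) 0.
  elim: s => [|g s ih].
    by rewrite big_nil -[RHS]l0; congr l; apply/funext => h; rewrite big_nil.
  rewrite big_cons -ih mulrC -ll; congr l; apply/funext => h.
  by rewrite big_cons.
rewrite -lsum.
have := vanish (fun h => y h + -1 *: \sum_(g <- undup S) qc (y g) 0 *: e g h).
rewrite lD lZ mulN1r => /(_ _)/subr0_eq; apply => h hS.
rewrite (bigD1_seq h) ?mem_undup ?undup_uniq //= /e eqxx -yreal big1 ?addr0.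
  by rewrite scaleN1r subrr.
by move=> g /negbTE gh; rewrite eq_sym gh scaler0.
Qed.

End continuous_linear_functionals.

Section outer_measure_image.
Context d (X : pointedType) (T : measurableType d) (R : realType).
Variables (mu : {outer_measure set X -> \bar R}) (f : X -> T).
Hypothesis mu_cara : forall A, measurable A -> mu.-caratheodory (f @^-1` A).
Hypothesis mu1 : mu setT = 1%E.
Local Open Scope ereal_scope.

Let P (A : set T) : \bar R := mu (f @^-1` A).

Let P0 : P set0 = 0.
Proof. by rewrite /P preimage_set0 outer_measure0. Qed.

Let P_ge0 A : 0 <= P A.
Proof. exact: outer_measure_ge0. Qed.

Let P_sigma_additive : semi_sigma_additive P.
Proof.
move=> F mF tF mUF.
rewrite /P preimage_bigcup.
apply: (@caratheodory_measure_sigma_additive _ _ mu (fun n => f @^-1` F n)).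
- by move=> n; exact: mu_cara.
- apply/trivIsetP => i j _ _ ij; rewrite -preimage_setI.
  by move/trivIsetP: tF => ->; rewrite ?preimage_set0.
- by rewrite -preimage_bigcup; exact: mu_cara.
Qed.

Let P1 : P setT = 1.
Proof. by rewrite /P preimage_setT. Qed.

HB.instance Definition _ := isMeasure.Build _ _ _ P P0 P_ge0 P_sigma_additive.
HB.instance Definition _ := Measure_isProbability.Build _ _ _ P P1.

Lemma outer_measure_image :
  exists Q : probability T R, forall A, Q A = mu (f @^-1` A).
Proof. by exists P. Qed.

End outer_measure_image.

Section representing_measure.
Variable G : zmodType.
Hypothesis exp2 : forall g : G, g + g = 0.
Variable phi : G -> quat.
Hypothesis phiP : Pstar G phi.

Let E := ext_boundary (Pstar G).

Lemma measurable_ext_boundary : measurable (E : set (qborel G)).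
Proof.
rewrite /E ext_boundary_Pstar //.
exact: (closed_qborel (bembed_closed (@sign_hom_closed G))).
Qed.

Lemma Pstar_representation : exists mu : probability (qborel G) RR,
  [/\ radon mu, mu (~` E) = 0%E & barycenter mu phi].
Proof.
have [hp h0] := phiP.
have [mu [muC mu_open mu_reg mu_null]] := @radon_extension (RR : realType) (bspace G)
  (@cylinder G) (cmass phi) (@bspace_compact G) (@cylinderT G) (@cylinderC G)
  (@cylinderI G) (@cylinder_open G) (@cylinder_base G)
  (fun V _ => @cmass_ge0 G exp2 phi V hp) (@cmassU G phi).
have mu1 : mu setT = 1%E.
  by rewrite muC; [rewrite cmassT h0 /qone qcE|exact: cylinderT].
(* The sets with Caratheodory measurable preimage form a sigma-algebra containing the open sets. *)
have mu_cara (A : set (qborel G)) : measurable A -> mu.-caratheodory (@bembed G @^-1` A).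
  move=> mA; pose C := [set A : set (qborel G) | mu.-caratheodory (@bembed G @^-1` A)].
  suff sub : <<s @open (qspace G) >> `<=` C by exact: sub.
  apply: smallest_sub; last first.
    move=> U oU; apply: mu_open; apply: open_comp => // x _.
    exact: bembed_continuous.
  split=> [|B CB|F CF].
  - by rewrite /C /= preimage_set0; exact: caratheodory_measurable_set0.
  - by rewrite /C /= setTD preimage_setC; exact: caratheodory_measurable_setC.
  - by rewrite /C /= preimage_bigcup; exact: caratheodory_measurable_bigcup.
have [P PE] := @outer_measure_image _ _ (qborel G) _ mu (@bembed G) mu_cara mu1.
have PE0 : P (~` E) = 0%E.
  rewrite PE; apply/eqP; rewrite eq_le outer_measure_ge0 andbT.
  (* A point whose image is not extreme violates multiplicativity at some pair, so it lies in a
     possibly uncountable union of open null sets. *)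
  rewrite -(mu_null _ (fun gh : G * G => not_mul gh.1 gh.2)).
  - apply: le_outer_measure => x nx; rewrite -[bigcup _ _]setCK -sign_hom_bigcap => hx.
    by apply: nx; rewrite /E ext_boundary_Pstar //; exists x.
  - by move=> gh; exact/cylinder_open/cylinder_not_mul.
  - by move=> gh; rewrite muC ?cmass_not_mul //; exact: cylinder_not_mul.
exists P; split=> //.
- move=> A mA; apply/eqP; rewrite eq_le; apply/andP; split; last first.
    apply: ge_ereal_sup => _ [C [_ CA] <-]; rewrite !PE.
    by apply: le_outer_measure; exact: preimage_subset.
  apply/lee_addgt0Pr => e e0.
  (* Inner regularity by complements: an open [U] tightly around the complement of the preimage of
     [A] leaves a compact set, whose image is the compact subset of [A] sought. *)
  have [U [oU AU Ule]] := mu_reg (~` (@bembed G @^-1` A)) e e0.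
  have cU : compact (~` U).
    by apply: subclosed_compact (@bspace_compact G) _ => //; exact: open_closedC.
  pose C := @bembed G @` (~` U).
  have CA : C `<=` A.
    by move=> _ [x nUx <-]; apply: contrapT => nAx; apply/nUx/AU.
  have leP : (mu (~` U) <= ereal_sup [set P C | C in [set C : set (qspace G) |
      compact C /\ C `<=` A]])%E.
    apply: (@le_trans _ _ (P C)).
      by rewrite PE; apply: le_outer_measure => x nUx; exists x.
    apply: ereal_sup_ubound; exists C => //; split=> //.
    apply: continuous_compact => //; apply: continuous_subspaceT.
    exact: bembed_continuous.
  apply: le_trans (leeD leP (lexx _)).
  have := mu_cara A mA setT; rewrite mu1 !setTI -PE => eA.
  have := le_outer_measureIC mu U setT; rewrite mu1 !setTI => eU.
  have fA : P A \is a fin_num by exact: fin_num_measure.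
  have fB B : mu B \is a fin_num.
    rewrite ge0_fin_numE ?outer_measure_ge0 //; apply: le_lt_trans (ltry 1).
    by rewrite -mu1; exact: le_outer_measure.
  move: eA eU Ule; rewrite -(fineK fA) -(fineK (fB (~` U))) -(fineK (fB U)).
  rewrite -(fineK (fB (~` (@bembed G @^-1` A)))) -!EFinD !lee_fin => -[].
  lra.
move=> l lcl; have [S [a lE]] := cont_lin_functional_finite lcl.
pose A g := [set y : qborel G | qc (y g) 0 = 1].
have mA g : measurable (A g).
  apply: (@closed_qborel G).
  by apply: (@closed_comp _ _ (fun z : qspace G => qc (z g) 0 : RR)
      [set 1]) => [z _|]; [exact: qspace_coord_continuous|exact: closed_eq].
have PA g : P (A g) = ((1 + qc (phi g) 0) / 2)%:E.
  rewrite PE (_ : _ @^-1` _ = [set x : bspace G | x g = true]).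
    rewrite muC ?cmass_coord //.
      by rewrite /restr add0r h0 /sgb /qone !qcE mul1r mulrC.
    by exists [:: g]; apply: determined_by_coord; rewrite mem_seq1.
  by apply/seteqP; split=> x; rewrite /A /= qc_bembed; case: (x g) => //; rewrite /sgb; lra.
have intA g : (\int[P]_y (\1_(A g) y)%:E)%E = ((1 + qc (phi g) 0) / 2)%:E.
  by rewrite integral_indic // setIT; exact: PA.
(* On the extreme boundary [y g] is 1 or -1, that is, twice the indicator of [A g] minus 1; so [l]
   is there a finite sum of the [t g]. *)
pose t g (y : qborel G) : \bar RR := ((2 * a g)%:E * (\1_(A g) y)%:E + (- a g)%:E)%E.
have i1 g : P.-integrable setT (fun y => (\1_(A g) y)%:E).
  exact: integrable_indic.
have i2 g : P.-integrable setT (fun y => ((2 * a g)%:E * (\1_(A g) y)%:E)%E).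
  exact: integrableZl.
have i3 (r : RR) : P.-integrable setT (cst r%:E).
  exact: finite_measure_integrable_cst.
have it g : P.-integrable setT (t g).
  exact: (integrableD measurableT (i2 g) (i3 (- a g))).
rewrite (ae_eq_integral (fun y => \sum_(g <- S) t g y)%E) //; last 3 first.
- apply/measurable_EFinP; exact: (continuous_qborel lcl.1).
- by apply: emeasurable_sum => g; exact: measurable_int (it g).
- exists (~` E); split=> //; first by apply: measurableC; exact: measurable_ext_boundary.
  move=> y /= ny Ey; apply: ny => _.
  move: Ey; rewrite /E ext_boundary_Pstar // => -[x hx <-].
  rewrite lE; last by move=> g; rewrite qc_bembed.
  rewrite -sumEFin; apply: eq_bigr => g _; rewrite /t -EFinM -EFinD; congr EFin.
  rewrite qc_bembed indicE (_ : (bembed x \in A g) = x g).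
    by case: (x g); rewrite /sgb /=; lra.
  apply/idP/idP => [/set_mem|xg]; last apply/mem_set; rewrite /A /= qc_bembed.
    by case: (x g) => //; rewrite /sgb; lra.
  by rewrite xg.
rewrite integral_sum // lE; last by move=> g; exact: qpos_def_real.
rewrite -sumEFin; apply: eq_bigr => g _.
rewrite (integralD measurableT (i2 g) (i3 (- a g))) (integralZl measurableT (i1 g)).
rewrite intA integral_cst // [X in (_ + _ * X)%E](probability_setT P).
by rewrite mule1 -EFinM -EFinD; congr EFin; lra.
Qed.

End representing_measure.

(** * Uniqueness of representing measures *)

Section uniqueness.
Variable G : zmodType.
Hypothesis exp2 : forall g : G, g + g = 0.

Let E : set (qborel G) := ext_boundary (Pstar G).
Let mE : measurable E := measurable_ext_boundary exp2.

Definition sign_cylinder (S : seq (G * bool)) : set (qborel G) :=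
  [set y | forall p, p \in S -> qc (y p.1) 0 = sgb p.2].

Lemma measurable_sign_cylinder S : measurable (sign_cylinder S).
Proof.
apply: (@closed_qborel G).
rewrite (_ : sign_cylinder S = \bigcap_(p in [set` S])
    ((fun y : qspace G => qc (y p.1) 0 : RR) @^-1` [set sgb p.2])) //.
apply: closed_bigI => p _; apply: closed_comp => [z _|]; last exact: closed_eq.
exact: qspace_coord_continuous.
Qed.

Lemma sign_cylinder_cat S S' : sign_cylinder (S ++ S') = sign_cylinder S `&` sign_cylinder S'.
Proof.
apply/seteqP; split=> y.
  by move=> h; split=> p pS; apply: h; rewrite mem_cat pS ?orbT.
by move=> [h h'] p; rewrite mem_cat => /orP[/h|/h'].
Qed.

Let qcE_ext (y : qborel G) : E y ->
  exists2 x, sign_hom x & forall g, qc (y g) 0 = sgb (x g).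
Proof.
rewrite /E ext_boundary_Pstar // => -[x hx <-]; exists x => // g.
exact: qc_bembed.
Qed.

Section moments.
Variables (phi : G -> quat) (mu : probability (qborel G) RR).
Hypothesis mu_ext : mu (~` E) = 0%E.
Hypothesis mu_phi : barycenter mu phi.

Let term S h (y : qborel G) : RR := \1_(sign_cylinder S) y * qc (y h) 0.

Let term_integrable S h : mu.-integrable E (EFin \o term S h).
Proof.
have muE : (mu E < +oo)%E by rewrite ltey_eq fin_num_measure.
apply: (measurable_bounded_integrable (R := RR : realType) mE muE).
  apply: measurable_funTS; apply: measurable_funM.
    exact: (@measurable_indic _ _ (RR : realType) _ _ (@measurable_sign_cylinder S)).
  exact: (continuous_qborel (@qspace_coord_continuous G h 0)).
exists 1; split=> [|M M1 y Ey]; first exact: num_real.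
apply: le_trans (ltW M1); have [x _ yx] := qcE_ext Ey.
rewrite /term yx indicE; case: (_ \in _); case: (x h); rewrite /sgb ?mulr1 ?mul1r ?mul0r
  ?normrN ?normr1 ?normr0 //.
Qed.

(** On [E] the indicator of the value [b] at [g] is [(1 + sgb b * y g) / 2], and
    [y g * y h = y (h + g)]. This is the recursion defining [restr]; the base case is the barycenter
    condition for a coordinate. *)
Lemma sign_cylinder_moment S h : (\int[mu]_(y in E) (term S h y)%:E =
  (qc (foldr (fun p f => restr f p.1 p.2) phi S h) 0)%:E)%E.
Proof.
elim: S h => [|[g b] S ih] h /=.
  have mc : measurable_fun setT (fun y : qborel G => (qc (y h) 0)%:E).
    apply/measurable_EFinP.
    exact: (continuous_qborel (@qspace_coord_continuous G h 0)).
  have := mu_phi (qspace_coord_cont_lin h 0) => <-.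
  rewrite [RHS](ae_eq_integral ((fun y : qborel G => (qc (y h) 0)%:E) \_ E)) //; last 2 first.
  - by apply/(measurable_restrictT _ mE); exact: measurable_funTS.
  - exists (~` E); split=> //; first exact: measurableC.
    by move=> y /= ny Ey; apply: ny => _; rewrite patchE mem_set.
  rewrite -integral_mkcond; apply: eq_integral => y _.
  rewrite /term indicE mem_set ?mul1r //.
have it1 := term_integrable S h; have it2 := term_integrable S (h + g).
have it2' : mu.-integrable E (fun y => (sgb b)%:E * (term S (h + g) y)%:E)%E.
  exact: (integrableZl mE _ it2).
transitivity (\int[mu]_(y in E)
   ((2^-1)%:E * ((term S h y)%:E + (sgb b)%:E * (term S (h + g) y)%:E)))%E.
  apply: eq_integral => y /set_mem/qcE_ext[x hx yx].
  rewrite -!EFinM; congr EFin; rewrite /term.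
  have -> : \1_(sign_cylinder ((g, b) :: S)) y = \1_(sign_cylinder S) y * (x g == b)%:R :> RR.
    rewrite !indicE -natrM mulnb; congr (nat_of_bool _)%:R.
    apply/idP/andP => [/set_mem yS|[/set_mem yS /eqP xb]].
      split; first by apply/mem_set => p pS; apply: yS; rewrite inE pS orbT.
      by apply/eqP/sgb_inj; rewrite -yx (yS (g, b)) // inE eqxx.
    by apply/mem_set => p; rewrite inE => /predU1P[->|/yS //]; rewrite yx xb.
  rewrite !yx hx -sgbM.
  by case: (x g); case: b {it2'}; case: (x h); rewrite /sgb /=; lra.
rewrite (integralZl mE (integrableD mE it1 it2')) (integralD mE it1 it2').
rewrite (integralZl mE it2) !ih -!EFinM; congr EFin.
by rewrite /restr !qcE.
Qed.

Lemma sign_cylinder_measure S :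
  mu (sign_cylinder S `&` E) = (qc (foldr (fun p f => restr f p.1 p.2) phi S 0) 0)%:E.
Proof.
rewrite -sign_cylinder_moment -integral_indic //; last exact: measurable_sign_cylinder.
apply: eq_integral => y /set_mem/qcE_ext[x hx yx].
by rewrite /term yx -[X in x X](addr0 0) hx eqxx /sgb mulr1.
Qed.

End moments.

Section two_measures.
Variables (phi : G -> quat) (mu nu : probability (qborel G) RR).
Hypotheses (mu_ext : mu (~` E) = 0%E) (nu_ext : nu (~` E) = 0%E).
Hypotheses (mu_phi : barycenter mu phi) (nu_phi : barycenter nu phi).
Hypothesis mu_radon : radon mu.

Let U (L : seq (seq (G * bool))) := \big[setU/set0]_(S <- L) sign_cylinder S.

Let mU L : measurable (U L).
Proof. by apply: bigsetU_measurable => S _; exact: measurable_sign_cylinder. Qed.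

(** Inclusion-exclusion, one cylinder at a time. The extra factor [S] is carried along because
    intersecting with the next cylinder only lengthens it to [S ++ S']. *)
Let unions_agree L S : mu (sign_cylinder S `&` E `&` U L) = nu (sign_cylinder S `&` E `&` U L).
Proof.
elim: L S => [|S' L ih] S; first by rewrite /U big_nil !setI0 !measure0.
rewrite /U big_cons -/(U L) setIUr.
have m1 : measurable (sign_cylinder S `&` E `&` sign_cylinder S').
  by apply: measurableI; [apply: measurableI|]; do ?exact: measurable_sign_cylinder.
have m2 : measurable (sign_cylinder S `&` E `&` U L).
  by apply: measurableI => //; apply: measurableI => //; exact: measurable_sign_cylinder.
have e1 : sign_cylinder S `&` E `&` sign_cylinder S' = sign_cylinder (S ++ S') `&` E.
  by rewrite sign_cylinder_cat setIAC.
have e2 : sign_cylinder S `&` E `&` sign_cylinder S' `&` (sign_cylinder S `&` E `&` U L) =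
    sign_cylinder (S ++ S') `&` E `&` U L.
  by rewrite -e1 setIACA setIid setIA.
rewrite !measureUfinr //; [|by rewrite ltey_eq fin_num_measure..].
rewrite e2 e1; congr (_ + _ - _)%E; [|exact: ih|exact: ih].
have := sign_cylinder_measure mu_ext mu_phi (S ++ S').
by rewrite -(sign_cylinder_measure nu_ext nu_phi).
Qed.

(** By inner regularity of [mu] it suffices to bound compact [C] inside [Q] and [E]. Compactness
    puts between [C] and [Q] a finite union of sign cylinders cut with [E], on which [mu] and [nu]
    agree. *)
Lemma open_measure_le (Q : set (qspace G)) : open Q -> (mu Q <= nu Q)%E.
Proof.
move=> oQ; have mQ := open_qborel oQ.
have Q0 : mu (Q `\` E) = 0%E.
  apply/eqP; rewrite eq_le measure_ge0 andbT -[leRHS]mu_ext.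
  apply: le_measure; [|by rewrite inE; exact: measurableC|by move=> y []].
  by rewrite inE; exact: measurableD.
have -> : mu Q = mu (Q `&` E).
  by have := measureDI mu mQ mE; rewrite [X in _ = (X + _)%E]Q0 add0e.
rewrite mu_radon; last exact: measurableI.
apply: ge_ereal_sup => _ [C [cC CQE] <-].
have clC : closed C by apply: compact_closed cC; exact: qspace_hausdorff.
have cC' : cover_compact (@bembed G @^-1` C).
  rewrite -compact_cover; apply: (subclosed_compact _ (@bspace_compact G)) => //.
  by apply: closed_comp => // x _; exact: bembed_continuous.
(* Each point of [C] has finitely many coordinates that already force an element of [E] into [Q];
   the list is [[::]] for [z] outside the preimage of [C]. *)
have ch (z : bspace G) : exists S : seq G, C (bembed z) ->
    forall y, E y -> (forall g, g \in S -> y g = bembed z g) -> Q y.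
  have [Cz|nCz] := pselect (C (bembed z)); last by exists [::].
  have [Qz _] := CQE _ Cz.
  have [S [N [zN NQ]]] := ptws_nbhs (open_nbhs_nbhs (conj oQ Qz)).
  exists S => _ y _ yz; apply: NQ => g gS; rewrite yz //.
  exact: nbhs_singleton (zN g).
have [s sP] := choice ch.
have [| |D' DC CD] := cC' (bspace G) (@bembed G @^-1` C)
    (fun z => [set z' : bspace G | {in s z, z =1 z'}]).
- by move=> z _; apply: cylinder_open; exists (s z) => a b ab za g gS; rewrite za // ab.
- by move=> z Cz; exists z.
pose L := [seq [seq (g, z g) | g <- s z] | z <- finmap.enum_fset D'].
have CL : C `<=` sign_cylinder [::] `&` E `&` U L.
  move=> y Cy; have [_ Ey] := CQE _ Cy; split; first by split.
  have [x hx xy] : exists2 x, sign_hom x & bembed x = y.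
    by move: Ey; rewrite /E ext_boundary_Pstar // => -[x]; exists x.
  have [|z /= zD zx] := CD x; first by rewrite /= xy.
  rewrite /U big_map -bigcup_seq; exists z => //= _ /mapP[g gS ->] /=.
  by rewrite -xy qc_bembed zx.
have LQ : sign_cylinder [::] `&` E `&` U L `<=` Q.
  move=> y [[_ Ey]]; rewrite /U big_map -bigcup_seq => -[z /= zD yz].
  have Cz : C (bembed z) by have /set_mem := DC _ zD.
  apply: (sP z Cz) => // g gS.
  have [x hx xy] : exists2 x, sign_hom x & bembed x = y.
    by move: Ey; rewrite /E ext_boundary_Pstar // => -[x]; exists x.
  have := yz (g, z g) (map_f _ gS); rewrite -xy qc_bembed /= => /sgb_inj.
  by rewrite /bembed => ->.
have mL : measurable (sign_cylinder [::] `&` E `&` U L).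
  by apply: measurableI => //; apply: measurableI => //; exact: measurable_sign_cylinder.
apply: (@le_trans _ _ (mu (sign_cylinder [::] `&` E `&` U L))).
  by apply: le_measure; rewrite ?inE //; exact: closed_qborel.
by rewrite unions_agree; apply: le_measure; rewrite ?inE.
Qed.

End two_measures.

Lemma Pstar_representation_unique phi (mu nu : probability (qborel G) RR) :
  [/\ radon mu, mu (~` E) = 0%E & barycenter mu phi] ->
  [/\ radon nu, nu (~` E) = 0%E & barycenter nu phi] ->
  forall A : set (qborel G), measurable A -> nu A = mu A.
Proof.
move=> [rmu emu bmu] [rnu enu bnu] A mA.
have openE B : @open (qspace G) B -> nu B = mu B.
  move=> oB; apply/eqP; rewrite eq_le.
  by rewrite (open_measure_le enu emu bnu bmu rnu oB)
    (open_measure_le emu enu bmu bnu rmu oB).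
apply: (@measure_unique _ (RR : realType) (qborel G) (@open (qspace G)) (fun=> setT)
  erefl _ _ _ nu mu openE _ A mA).
- by move=> B C oB oC; exact: openI.
- by move=> _; exact: openT.
- by apply/seteqP; split=> // y _; exists 0%N.
- by move=> _; rewrite ltey_eq fin_num_measure.
Qed.

End uniqueness.

Theorem mainTheorem16 (G : zmodType) :
  bauer_simplex (Pstar G) <-> (forall g : G, g + g = 0)%R.
Proof.
split=> [|exp2]; first exact: bauer_simplex_exponent.
split.
- exact: Pstar_compact.
- exact: Pstar_convex.
- rewrite ext_boundary_Pstar //.
  exact: (bembed_closed (@sign_hom_closed G)).
- move=> phi phiP; have [mu muP] := Pstar_representation exp2 phiP.
  exists mu; split=> // nu nuP; exact: (Pstar_representation_unique exp2 muP nuP).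
Qed.
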